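(* Let $(\theta_n)_{n\ge0}$ be generated by MLMC-AMSGrad as described in the context, with $\rho_1,\rho_2\in[0,1)$, $\delta>0$, a positive non-increasing sequence $(\gamma_n)_{n\ge1}$ and positive non-decreasing sequences $(T_n)_{n\ge1}$, $(\varepsilon_n)_{n\ge1}$. Assume: (i) $V:\mathbb{R}^d\to\mathbb{R}$ is differentiable and $\|\nabla V(\theta)-\nabla V(\theta')\|\le L\|\theta-\theta'\|$ for all $\theta,\theta'\in\mathbb{R}^d$; (ii) there is $G>0$ such that $\|H_\theta\|_\infty\le G$ for all $\theta\in\mathbb{R}^d$; (iii) there are constants $c_1,c_2$ such that for all $n\ge 0$, $$\left\|\mathbb{E}[\widehat H^{(n+1)}\mid\mathcal F_n]-h(\theta_n)\right\|\le \frac{c_1G}{T_{n+1}},\qquad \mathbb{E}\left[\|\widehat H^{(n+1)}\|^2\right]\le c_2G^2\log(T_{n+1});$$ (iv) for all $n\ge1$, $\gamma_n\propto n^{-\gamma}$, $\varepsilon_n\propto n^{\overline\varepsilon}$, $T_n\propto n^\alpha$, where $\alpha>0$ and $\gamma,\overline\varepsilon\ge0$ are constants with $2\gamma+\overline\varepsilon<2$. Define $\underline\varepsilon_0=0$ and $\underline\varepsilon_n=\left(\delta+\varepsilon_n(1-\rho_2^n)\right)^{-1/2}$ for $n\ge1$. For $N\ge1$ put $\varpi_N=\sum_{k=0}^N\gamma_{k+1}\underline\varepsilon_k$ and let $R$ be a random variable, independent of the algorithm, with $\mathbb{P}[R=n]=\gamma_{n+1}\underline\varepsilon_n/\varpi_N$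 for $n\in\{0,\dots,N\}$. Then, as $N\to\infty$, $$\mathbb{E}\left[\|\nabla V(\theta_R)\|^2\right]=\mathcal O\left(\frac1{N^{1-\gamma-\overline\varepsilon/2}}\left\{1+\Psi_N(\alpha+\gamma)+\Phi_N(2\gamma)+\gamma\log N\right\}\right).$$
   Context: Setting. $\|\cdot\|$ is the Euclidean norm on $\mathbb{R}^d$. The function $V$ has a global minimizer $\theta^*\in\mathbb{R}^d$. For each $\theta\in\mathbb{R}^d$, $H_\theta:\mathbb{X}\to\mathbb{R}^d$ is a measurable function on a measurable space $\mathbb{X}\subseteq\mathbb{R}^q$, $\|H_\theta\|_\infty=\sup_{x\in\mathbb{X}}\|H_\theta(x)\|$, $P_\theta$ is a Markov kernel on $\mathbb{X}$ with invariant probability $\pi_\theta$, and $h(\theta)=\mathbb{E}_{\pi_\theta}[H_\theta(X)]$. Throughout it is assumed that $h(\theta)=\nabla V(\theta)$ for all $\theta$. MLMC estimator. $(K_n)_{n\ge1}$ are i.i.d. geometric, $\mathbb{P}(K_n=k)=2^{-k}$ for $k\ge1$. $\mathcal F_0$ is trivial and $\mathcal F_n=\sigma(K_1,\mathbf X^{(1)},\dots,K_n,\mathbf X^{(n)})$. At step $n\ge0$, given $\mathcal F_n$, $\mathbf X^{(n+1)}=(X_i^{(n+1)})_{i\ge1}$ is a Markov chain with kernel $P_{\theta_n}$, and $K_{n+1}$ is independent of $\mathcal F_n$ and $\mathbf X^{(n+1)}$. For an integer $p\ge1$ let $H_\theta^{(p)}(\mathbf x)=\frac1p\sum_{i=1}^pH_\theta(x_i)$.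 With $t_{n+1}=2^{K_{n+1}}$, the MLMC estimator is $$\widehat H^{(n+1)}=H_{\theta_n}(X_1^{(n+1)})+t_{n+1}\left\{H_{\theta_n}^{(t_{n+1})}(\mathbf X^{(n+1)})-H_{\theta_n}^{(t_{n+1}/2)}(\mathbf X^{(n+1)})\right\}\mathbf 1_{t_{n+1}\le T_{n+1}}.$$ MLMC-AMSGrad. Start from $\theta_0\in\mathbb{R}^d$, $m_{-1}=0$, $W_{-1}=\widehat W_{-1}=0$. For $n\ge0$ set $$m_n=\rho_1m_{n-1}+(1-\rho_1)\widehat H^{(n+1)},\qquad W_n=\rho_2W_{n-1}+(1-\rho_2)\min\left\{\varepsilon_{n+1}I_d,\ \mathrm{Diag}\left(\widehat H^{(n+1)}(\widehat H^{(n+1)})^\top\right)\right\},$$ $$\widehat W_n=\max\{\widehat W_{n-1},W_n\},\qquad A_n=(\delta I_d+\widehat W_n)^{-1/2},\qquad \theta_{n+1}=\theta_n-\gamma_{n+1}A_nm_n.$$ Here $\mathrm{Diag}(M)$ is the diagonal matrix formed from the diagonal of $M$, and min and max of diagonal matrices are taken entrywise on the diagonal. Notation. $a_n\propto n^{s}$ means $a_n=c\,n^{s}$ for all $n\ge1$ with a constant $c>0$. For $\eta\in\mathbb{R}$: $\Psi_N(\eta)=N^{1-\eta}$ if $\eta<1$, $\log N$ if $\eta=1$, $1$ if $\eta>1$; $\Phi_N(\eta)=N^{1-\eta}\log N$ if $\eta<1$, $(\log N)^2$ if $\eta=1$, $1$ if $\eta>1$. *)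

(* Defs.v *)
From HB Require Import structures.
From mathcomp Require Import all_boot all_order all_algebra.
From mathcomp Require Import all_classical all_reals all_analysis.

Set Implicit Arguments.
Unset Strict Implicit.
Unset Printing Implicit Defensive.

Import Order.TTheory GRing.Theory Num.Theory.
Import numFieldNormedType.Exports.

Local Open Scope classical_set_scope.
Local Open Scope ring_scope.

Section euclidean_space.
Context {R : realType} {d : nat}.

(* Euclidean norm; the library norm on matrices, `|v|, is the sup norm. *)
Definition enorm (v : 'cV[R]_d) : R := Num.sqrt (\sum_i v i 0 ^+ 2).

Definition grad (V : 'cV[R]_d -> R) (x : 'cV[R]_d) : 'cV[R]_d :=
  \col_i 'D_(delta_mx i 0) V x.

Definition Diag (M : 'M[R]_d) : 'M[R]_d := diag_mx (\row_i M i i).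

(* The next three operations are only meant for diagonal matrices. *)
Definition diag_min (A B : 'M[R]_d) : 'M[R]_d :=
  diag_mx (\row_i Num.min (A i i) (B i i)).

Definition diag_max (A B : 'M[R]_d) : 'M[R]_d :=
  diag_mx (\row_i Num.max (A i i) (B i i)).

Definition diag_invsqrt (A : 'M[R]_d) : 'M[R]_d :=
  diag_mx (\row_i (Num.sqrt (A i i))^-1).

End euclidean_space.

Section rates.
Context {R : realType}.

(* a_n \propto n^s, for n >= 1 *)
Definition propto_pow (a : nat -> R) (s : R) : Prop :=
  exists2 c : R, 0 < c & forall n, (1 <= n)%N -> a n = c * n%:R `^ s.

Definition Psi (N : nat) (eta : R) : R :=
  if eta < 1 then N%:R `^ (1 - eta)
  else if eta == 1 then ln N%:R else 1.

Definition Phi (N : nat) (eta : R) : R :=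
  if eta < 1 then N%:R `^ (1 - eta) * ln N%:R
  else if eta == 1 then ln N%:R ^+ 2 else 1.

(* \underline{\varepsilon}_n *)
Definition ueps (delta rho2 : R) (eps : nat -> R) (n : nat) : R :=
  if n is 0 then 0
  else (Num.sqrt (delta + eps n * (1 - rho2 ^+ n)))^-1.

(* \varpi_N *)
Definition varpi (gam ue : nat -> R) (N : nat) : R :=
  \sum_(0 <= k < N.+1) gam k.+1 * ue k.

End rates.

Section random_field.
Context {R : realType} {d : nat} {dX : measure_display}
  {X : measurableType dX}.
Implicit Type H : X -> 'cV[R]_d.

Definition measurable_vec H : Prop :=
  forall i, measurable_fun [set: X] (fun x => H x i 0).

Definition supnorm H : \bar R :=
  ereal_sup [set (enorm (H x))%:E | x in [set: X]].

Definition mean_field (pi : probability X R) H : 'cV[R]_d :=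
  \col_i \int[pi]_x H x i 0.

(* H^(p)(x); sequences are indexed from 1, x 0 is not used. *)
Definition avg H (p : nat) (x : nat -> X) : 'cV[R]_d :=
  p%:R^-1 *: \sum_(1 <= i < p.+1) H (x i).

(* The MLMC estimator with t = 2^k and truncation level T. *)
Definition mlmc H (T : R) (x : nat -> X) (k : nat) : 'cV[R]_d :=
  let t := (2 ^ k)%N in
  H (x 1%N) +
  (t%:R <= T)%R%:R *: (t%:R *: (avg H t x - avg H (t %/ 2)%N x)).

End random_field.

Section amsgrad.
Context {R : realType} {d : nat}.
Variables (rho1 rho2 delta : R) (gam eps : nat -> R) (theta0 : 'cV[R]_d).

(* State n holds theta_n, m_(n-1), W_(n-1) and \widehat{W}_(n-1). *)
Record amsgrad_state := AmsgradState {
  as_theta : 'cV[R]_d;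
  as_m : 'cV[R]_d;
  as_W : 'M[R]_d;
  as_What : 'M[R]_d
}.

Definition amsgrad_step (n : nat) (s : amsgrad_state) (g : 'cV[R]_d) :=
  let m := rho1 *: as_m s + (1 - rho1) *: g in
  let W := rho2 *: as_W s
           + (1 - rho2) *: diag_min (eps n.+1)%:M (Diag (g *m g^T)) in
  let What := diag_max (as_What s) W in
  let A := diag_invsqrt (delta%:M + What) in
  AmsgradState (as_theta s - gam n.+1 *: (A *m m)) m W What.

(* Step n is driven by the estimator est n.+1, evaluated at theta_n. *)
Fixpoint amsgrad (est : nat -> 'cV[R]_d -> 'cV[R]_d) (n : nat) :
    amsgrad_state :=
  if n is n'.+1 then
    let s := amsgrad est n' in amsgrad_step n' s (est n (as_theta s))
  else AmsgradState theta0 0 0 0.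

Section mlmc_run.
Context {dX : measure_display} {X : measurableType dX} {Omega : Type}.
Variables (H : 'cV[R]_d -> X -> 'cV[R]_d) (T : nat -> R).
Variables (Xs : nat -> nat -> Omega -> X) (K : nat -> Omega -> nat).

(* theta_n along the run; Xs n i is X_i^(n), used for n, i >= 1 only. *)
Definition mlmc_theta (n : nat) (w : Omega) : 'cV[R]_d :=
  as_theta (amsgrad
    (fun k theta => mlmc (H theta) (T k) (fun i => Xs k i w) (K k w)) n).

(* \widehat{H}^(n), for n >= 1 *)
Definition mlmc_Hhat (n : nat) (w : Omega) : 'cV[R]_d :=
  mlmc (H (mlmc_theta n.-1 w)) (T n) (fun i => Xs n i w) (K n w).

End mlmc_run.
End amsgrad.

Section probability.
Context {dO : measure_display} {Omega : measurableType dO} {R : realType}.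
Variable P : probability Omega R.

Definition sigma_of {dY} {Y : measurableType dY} (f : Omega -> Y) :
    set (set Omega) :=
  preimage_set_system [set: Omega] f measurable.

Definition measurable_wrt (F : set (set Omega)) (f : Omega -> R) : Prop :=
  forall B : set R, measurable B -> F (f @^-1` B).

Definition independent (F G : set (set Omega)) : Prop :=
  forall A B, F A -> G B -> P (A `&` B) = (P A * P B)%E.

(* Z is a version of the conditional expectation E[Y | F], where F is a
   sub-sigma-algebra of the measurable sets. *)
Definition is_condexp (F : set (set Omega)) (Y Z : Omega -> R) : Prop :=
  [/\ P.-integrable [set: Omega] (EFin \o Y),
      P.-integrable [set: Omega] (EFin \o Z),
      measurable_wrt F Z &
      forall A, F A ->
        (\int[P]_(w in A) (Z w)%:E = \int[P]_(w in A) (Y w)%:E)%E].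

Definition is_condexp_vec {d : nat} (F : set (set Omega))
    (Y Z : Omega -> 'cV[R]_d) : Prop :=
  forall i, is_condexp F (fun w => Y w i 0) (fun w => Z w i 0).

Section sampling.
Context {dX : measure_display} {X : measurableType dX}.
Variables (Xs : nat -> nat -> {RV P >-> X}) (K : nat -> {RV P >-> nat}).

(* Events depending on X_i^(n), for i in I. *)
Definition chain_events (n : nat) (I : set nat) : set (set Omega) :=
  \bigcup_(i in I) sigma_of (Xs n i).

(* sigma(K_n, X^(n) : n in J); the index set of each X^(n) is {1, 2, ...}. *)
Definition history (J : set nat) : set (set Omega) :=
  <<s \bigcup_(n in J)
        (sigma_of (K n) `|` chain_events n [set i | (1 <= i)%N]) >>.

(* F_n *)
Definition past (n : nat) : set (set Omega) :=
  history [set k | (1 <= k <= n)%N].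

(* sigma(F_n, X_i^(n+1) : i in I) *)
Definition past_chain (n : nat) (I : set nat) : set (set Omega) :=
  <<s past n `|` chain_events n.+1 I >>.

(* The conditional law of the samples, given the iterates theta_n. By
   mlmc_fresh, K_(n+1) is in particular independent of (K_1, ..., K_n), so the
   K_n are i.i.d. The law of X_1^(n+1) given F_n is left arbitrary. *)
Record mlmc_sampling {d : nat} (theta : nat -> Omega -> 'cV[R]_d)
    (kern : 'cV[R]_d -> R.-pker X ~> X) : Prop := {
  mlmc_geometric : forall n k, (1 <= n)%N -> (1 <= k)%N ->
    P (K n @^-1` [set k]) = ((2 ^+ k)^-1)%:E;
  mlmc_fresh : forall n,
    independent (sigma_of (K n.+1)) (past_chain n [set i | (1 <= i)%N]);
  mlmc_markov : forall n i (B : set X), (1 <= i)%N -> measurable B ->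
    is_condexp (past_chain n [set j | (1 <= j <= i)%N])
      (fun w => \1_B (Xs n.+1 i.+1 w))
      (fun w => fine (kern (theta n w) (Xs n.+1 i w) B))
}.

End sampling.
End probability.

(* Main.v *)
Require Import Defs.
From HB Require Import structures.
From mathcomp Require Import all_boot all_order all_algebra.
From mathcomp Require Import all_classical all_reals all_analysis.
From mathcomp Require Import measurable_realfun.
From mathcomp Require Import zify ring lra.

Set Implicit Arguments.
Unset Strict Implicit.
Unset Printing Implicit Defensive.

Import Order.TTheory GRing.Theory Num.Theory.
Import numFieldNormedType.Exports.

Local Open Scope classical_set_scope.
Local Open Scope ring_scope.

(** Write h_n for the gradient of V at theta_n, g_n for the stochastic gradient
used at step n, A_n for the diagonal matrix (delta + What_n)^(-1/2) and
v_n = gamma_(n+1) A_n m_n for the displacement theta_n - theta_(n+1).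

Along a fixed trajectory, smoothness of V gives
V(theta_(n+1)) <= V(theta_n) - <h_n, v_n> + K |v_n|^2, so the sum of the scalar
products <h_n, v_n> is at most V(theta_0) - min V plus a multiple of the sum of
gamma_(n+1)^2 |m_n|^2. Expanding m_n once,
<h_n, v_n> is rho1 <h_(n-1), v_(n-1)> + (1 - rho1) gamma_(n+1) <h_n, A_(n-1) g_n>
up to three errors: the change of gradient between theta_(n-1) and theta_n, of
order |v_(n-1)|^2; the change from A_(n-1) to A_n, whose sum telescopes because
the diagonal entries of A_n decrease and stay in [0, delta^(-1/2)]; and the
decrease of gamma, which telescopes too. Summation gives an upper bound for the
sum of gamma_(n+1) <h_n, A_(n-1) g_n> (amsgrad_pathwise), where only squares of
the momentum have to be controlled.

The point of having A_(n-1) rather than A_n in that sum is that A_(n-1) and h_n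
are F_n-measurable and bounded, so that in expectation g_n can be replaced by
its conditional expectation given F_n, which is h_n up to c1 G / T_(n+1)
(E_mul_eq0, drift_le). Clipping bounds A_(n-1) below by the deterministic
quantity ueps_n. The squared momentum is a convex combination of past squared
estimators, hence has expectation O(log T_(n+1)) (momentum_sqr_le). The outcome is
amsgrad_expected_gradient, a bound on the sum of
gamma_(n+1) ueps_n E|h_n|^2 by a constant plus the sums of
gamma_(n+1)^2 log T_(n+1), (gamma_n - gamma_(n+1)) log T_(n+1) and
gamma_(n+1) / T_(n+1).

For power sequences these sums are of order 1 + Phi_N(2 gamma), gamma log N and
1 + Psi_N(alpha + gamma), while varpi_N is at least of order
N^(1 - gamma - ebar / 2) (varpi_lower). Since R is independent of the run, the
expectation of |h_R|^2 is the corresponding weighted average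
(expectation_random_index), and dividing gives the rate. *)

(** * Descent along one trajectory *)

Lemma young_le (R : realFieldType) (x y : R) : x * y <= 2^-1 * (x ^+ 2 + y ^+ 2).
Proof. have := sqr_ge0 (x - y); rewrite sqrrB mulr2n; lra. Qed.

Lemma enorm_sqr (R : realType) (d : nat) (v : 'cV[R]_d) :
  enorm v ^+ 2 = \sum_i v i 0 ^+ 2.
Proof. by rewrite sqr_sqrtr// sumr_ge0// => i _; exact: sqr_ge0. Qed.

Lemma enorm_ge0 (R : realType) (d : nat) (v : 'cV[R]_d) : 0 <= enorm v.
Proof. exact: sqrtr_ge0. Qed.

Lemma coord_le_enorm (R : realType) (d : nat) (v : 'cV[R]_d) (i : 'I_d) :
  `|v i 0| <= enorm v.
Proof.
rewrite -sqrtr_sqr ler_sqrt; last by rewrite sumr_ge0// => j _; exact: sqr_ge0.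
by rewrite (bigD1 i)//= lerDl sumr_ge0// => j _; exact: sqr_ge0.
Qed.

(** The factor L^2 + 1 instead of L^2 provides a constant that is at least 1
whatever the sign of L, and also absorbs the terms of Young's inequality. *)
Lemma enorm_lipschitz_sqr (R : realType) (d : nat) (L : R) (u v : 'cV[R]_d) :
  enorm u <= L * enorm v ->
  \sum_i u i 0 ^+ 2 <= (L ^+ 2 + 1) * \sum_i v i 0 ^+ 2.
Proof.
move=> uv; rewrite -!enorm_sqr mulrDl mul1r ler_wpDr ?sqr_ge0//.
by rewrite -exprMn ler_sqr ?nnegrE ?enorm_ge0// (le_trans (enorm_ge0 u)).
Qed.

Lemma derive_gradE (R : realType) (d : nat) (V : 'cV[R]_d -> R)
    (x v : 'cV[R]_d) : differentiable V x ->
  'D_v V x = \sum_i grad V x i 0 * v i 0.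
Proof.
move=> dV; rewrite deriveE//.
have {1}-> : v = \sum_i v i 0 *: delta_mx i 0.
  apply/matrixP => i j; rewrite summxE (bigD1 i)//= !mxE !ord1 !eqxx mulr1.
  by rewrite big1 ?addr0// => k ki; rewrite !mxE eq_sym (negPf ki) mulr0.
rewrite linear_sum; apply: eq_bigr => i _.
by rewrite linearZ /= !mxE deriveE// mulrC.
Qed.

(** By the mean value theorem the increment of V along v is the derivative at an
intermediate point, and the gradient there differs from the one at x by at most
L |v|. The constant is worse than the usual L / 2, which does not affect rates. *)
Lemma descent_step (R : realType) (d : nat) (V : 'cV[R]_d -> R) (L : R)
    (x v : 'cV[R]_d) :
  (forall y, differentiable V y) ->
  (forall y z, enorm (grad V y - grad V z) <= L * enorm (y - z)) ->
  V (x - v) <= V x - \sum_i grad V x i 0 * v i 0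
               + (L ^+ 2 + 1) * \sum_i v i 0 ^+ 2.
Proof.
move=> dV LV.
pose f (t : R) := V (x - t *: v).
have df (t : R) : is_derive t 1 f (- \sum_i grad V (x - t *: v) i 0 * v i 0).
  have E : (fun h : R => f (h *: 1 + t)) =
      (fun h : R => V (h *: (- v) + (x - t *: v))).
    apply/funext => h; rewrite /f; congr V.
    by apply/matrixP => i j; rewrite -[h *: 1]/(h * 1) !mxE; ring.
  have dfx : derivable f t 1.
    apply/derivable1P; rewrite E.
    apply/(derivable1P V (x - t *: v) (- v)).
    exact: (@diff_derivable R _ _ V (x - t *: v) (- v) (dV _)).
  split => //.
  have -> : 'D_1 f t = 'D_(- v) V (x - t *: v).
    rewrite /derive; set g1 := fun h => h^-1 *: _; set g2 := fun h => h^-1 *: _.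
    suff -> : g1 = g2 by [].
    apply/funext => h; rewrite /g1 /g2 /=.
    by have /(congr1 (fun k => k h)) /= -> := E.
  rewrite derive_gradE// -sumrN; apply: eq_bigr => i _.
  by rewrite !mxE mulrN.
have [|c c01] := @MVT R f _ 0 1 ltr01 (fun t _ => df t).
  apply: continuous_subspaceT => t; apply: differentiable_continuous.
  by apply/derivable1_diffP; have [] := df t.
rewrite /f scale1r scale0r subr0 subr0 mulr1 => e.
rewrite -(subrK (V x) (V (x - v))) e addrC -addrA lerD2l -subr_ge0.
pose u := grad V x - grad V (x - c *: v).
have cv : \sum_i (c *: v) i 0 ^+ 2 <= \sum_i v i 0 ^+ 2.
  apply: ler_sum => i _; rewrite mxE exprMn ler_piMl ?sqr_ge0//.
  by move: c01; rewrite in_itv /= => /andP[c0 c1]; rewrite exprn_ile1// ltW.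
have u2 : \sum_i u i 0 ^+ 2 <= L ^+ 2 * \sum_i v i 0 ^+ 2.
  apply: (@le_trans _ _ (L ^+ 2 * \sum_i (c *: v) i 0 ^+ 2)); last first.
    by rewrite ler_wpM2l ?sqr_ge0.
  have := LV x (x - c *: v); rewrite subKr -/u => Lu.
  rewrite -!enorm_sqr -exprMn ler_sqr ?nnegrE ?enorm_ge0//.
  exact: le_trans (enorm_ge0 u) Lu.
have uv : \sum_i u i 0 * v i 0 <=
    2^-1 * (\sum_i u i 0 ^+ 2 + \sum_i v i 0 ^+ 2).
  rewrite -big_split /= mulr_sumr; apply: ler_sum => i _; exact: young_le.
have v0 : 0 <= L ^+ 2 * \sum_i v i 0 ^+ 2.
  by rewrite mulr_ge0 ?sqr_ge0// sumr_ge0// => i _; exact: sqr_ge0.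
have v1 : 0 <= \sum_i v i 0 ^+ 2 by rewrite sumr_ge0// => i _; exact: sqr_ge0.
have uE : \sum_i u i 0 * v i 0 = \sum_i grad V x i 0 * v i 0
    - \sum_i grad V (x - c *: v) i 0 * v i 0.
  by rewrite -sumrB; apply: eq_bigr => i _; rewrite -mulrBl !mxE.
lra.
Qed.

(** The case of one coordinate and one step: a and a' are the entries of A_(n-1)
and A_n, h' and h those of the gradient at the previous and the current
iterate, ga' and ga the previous and the current step size. It is the
decomposition
(1 - rho) ga h a g = h (ga a' m') - rho h' (ga' a m)
  + ga h (a - a') m' - rho (h - h') (ga' a m) + rho (ga' - ga) h a m,
with Young's inequality applied to the last three terms. *)
Lemma amsgrad_coord_step (R : realFieldType)
    (rho G a0 ga ga' a a' h h' g m : R) :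
  let m' := rho * m + (1 - rho) * g in
  0 <= rho <= 1 -> 0 <= ga <= ga' -> 0 <= a' <= a -> a <= a0 -> `|h| <= G ->
  (1 - rho) * (ga * (h * a * g)) <=
    h * (ga * a' * m') - rho * (h' * (ga' * a * m))
    + (2^-1 * (h - h') ^+ 2 + 2^-1 * (ga' * a * m) ^+ 2)
    + G * a0 * (a - a') + G * (ga ^+ 2 * m' ^+ 2)
    + G * a0 * ((ga' - ga) * (1 + m ^+ 2)).
Proof.
move=> m' /andP[r0 r1] /andP[g0 gg'] /andP[a'0 aa'] aa0 hG.
have G0 : 0 <= G by apply: le_trans hG.
have a_ge0 : 0 <= a by lra.
have hb (t s : R) : `|t| <= s -> h * t <= G * s.
  move=> ts; rewrite (le_trans (ler_norm _))// normrM.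
  by rewrite ler_pM.
have e1 : h * (ga * (a - a') * m') <= G * (a0 * (a - a') + ga ^+ 2 * m' ^+ 2).
  apply: hb; rewrite ler_norml; apply/andP; split.
    have := young_le (a - a') (- (ga * m')).
    have : (a - a') ^+ 2 <= a0 * (a - a') by rewrite expr2 ler_wpM2r//; lra.
    have := sqr_ge0 (a - a'); have := sqr_ge0 (ga * m').
    rewrite sqrrN exprMn; lra.
  have := young_le (a - a') (ga * m').
  have : (a - a') ^+ 2 <= a0 * (a - a') by rewrite expr2 ler_wpM2r//; lra.
  have := sqr_ge0 (a - a'); have := sqr_ge0 (ga * m').
  rewrite exprMn; lra.
have e2 : - (rho * ((h - h') * (ga' * a * m))) <=
    2^-1 * (h - h') ^+ 2 + 2^-1 * (ga' * a * m) ^+ 2.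
  have := young_le (- (h - h')) (ga' * a * m).
  have y0 : 0 <= 2^-1 * (h - h') ^+ 2 + 2^-1 * (ga' * a * m) ^+ 2.
    by rewrite addr_ge0 // mulr_ge0 ?sqr_ge0 ?invr_ge0.
  rewrite sqrrN => y1.
  have [p0|p0] := lerP 0 (- (h - h') * (ga' * a * m)).
    apply: le_trans (_ : - (h - h') * (ga' * a * m) <= _); last lra.
    have : rho * (- (h - h') * (ga' * a * m)) <= - (h - h') * (ga' * a * m).
      by rewrite ler_piMl.
    lra.
  have : rho * (- (h - h') * (ga' * a * m)) <= 0.
    by rewrite mulr_ge0_le0// ltW.
  lra.
have e3 : rho * ((ga' - ga) * (h * (a * m))) <=
    G * a0 * ((ga' - ga) * (1 + m ^+ 2)).
  have D0 : 0 <= ga' - ga by lra.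
  have am : `|a * m| <= a0 * (1 + m ^+ 2).
    rewrite normrM (ger0_norm a_ge0) ler_pM//.
    have := sqr_ge0 (`|m| - 1); rewrite sqrrB1 real_normK ?num_real// mulr2n.
    have := normr_ge0 m; lra.
  have := hb _ _ am => hb'.
  apply: le_trans (_ : rho * ((ga' - ga) * (G * (a0 * (1 + m ^+ 2)))) <= _).
    by rewrite ler_wpM2l// ler_wpM2l.
  have X0 : 0 <= (ga' - ga) * (G * (a0 * (1 + m ^+ 2))).
    do 3 rewrite mulr_ge0 //; [lra|by rewrite addr_ge0 ?sqr_ge0].
  have : rho * ((ga' - ga) * (G * (a0 * (1 + m ^+ 2)))) <=
         (ga' - ga) * (G * (a0 * (1 + m ^+ 2))) by rewrite ler_piMl.
  lra.
have -> : (1 - rho) * (ga * (h * a * g)) =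
  h * (ga * a' * m') - rho * (h' * (ga' * a * m))
  + h * (ga * (a - a') * m') - rho * ((h - h') * (ga' * a * m))
  + rho * ((ga' - ga) * (h * (a * m))).
  by rewrite /m'; ring.
lra.
Qed.

Section pathwise.
Context {R : realType} {d : nat}.
Variables (rho G a0 K fmin : R) (f ga : nat -> R).
Variables (h a g m : nat -> 'I_d -> R).
Let v n i := ga n.-1 * a n i * m n i.
Hypothesis rho01 : 0 <= rho <= 1.
Hypothesis K_ge1 : 1 <= K.
Hypothesis G_ge0 : 0 <= G.
Hypothesis ga_ge0 : forall n, 0 <= ga n.
Hypothesis ga_noninc : forall n, ga n.+1 <= ga n.
Hypothesis a_init : forall i, a 0%N i = a0.
Hypothesis a_ge0 : forall n i, 0 <= a n i.
Hypothesis a_noninc : forall n i, a n.+1 i <= a n i.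
Hypothesis h_bound : forall n i, `|h n i| <= G.
Hypothesis m_init : forall i, m 0%N i = 0.
Hypothesis mS : forall n i, m n.+1 i = rho * m n i + (1 - rho) * g n i.
Hypothesis f_descent : forall n,
  f n.+1 <= f n - \sum_i h n i * v n.+1 i + K * \sum_i v n.+1 i ^+ 2.
Hypothesis h_lip : forall n,
  \sum_i (h n.+1 i - h n i) ^+ 2 <= K * \sum_i v n.+1 i ^+ 2.
Hypothesis f_min : forall n, fmin <= f n.

Let a_le n i : a n i <= a0.
Proof. by elim: n => [|n IH]; [rewrite a_init|rewrite (le_trans (a_noninc n i))]. Qed.

Let v_init i : v 0%N i = 0.
Proof. by rewrite /v m_init mulr0. Qed.

Let ga_pred n : 0 <= ga n <= ga n.-1.
Proof. by rewrite ga_ge0; case: n => //=. Qed.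

Let step n :
  (1 - rho) * (ga n * \sum_i h n i * a n i * g n i) <=
    \sum_i h n i * v n.+1 i - rho * \sum_i h n.-1 i * v n i
    + K * \sum_i v n i ^+ 2
    + G * a0 * (\sum_i a n i - \sum_i a n.+1 i)
    + G * (ga n ^+ 2 * \sum_i m n.+1 i ^+ 2)
    + G * a0 * ((ga n.-1 - ga n) * \sum_i (1 + m n i ^+ 2)).
Proof.
have lip : 2^-1 * \sum_i (h n i - h n.-1 i) ^+ 2
    + 2^-1 * \sum_i v n i ^+ 2 <= K * \sum_i v n i ^+ 2.
  have s0 : 0 <= \sum_i v n i ^+ 2 by rewrite sumr_ge0// => i _; exact: sqr_ge0.
  have : \sum_i v n i ^+ 2 <= K * \sum_i v n i ^+ 2 by rewrite ler_peMl.
  have : \sum_i (h n i - h n.-1 i) ^+ 2 <= K * \sum_i v n i ^+ 2.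
    case: n s0 => [s0|n _] //=; rewrite big1 => [|i _]; last by rewrite subrr expr0n.
    by rewrite mulr_ge0// (le_trans ler01).
  lra.
apply: le_trans (_ : \sum_i h n i * v n.+1 i - rho * \sum_i h n.-1 i * v n i
    + (2^-1 * \sum_i (h n i - h n.-1 i) ^+ 2 + 2^-1 * \sum_i v n i ^+ 2)
    + G * a0 * (\sum_i a n i - \sum_i a n.+1 i)
    + G * (ga n ^+ 2 * \sum_i m n.+1 i ^+ 2)
    + G * a0 * ((ga n.-1 - ga n) * \sum_i (1 + m n i ^+ 2)) <= _); last lra.
rewrite !mulr_sumr -!sumrB !mulr_sumr -!big_split /=.
apply: ler_sum => i _; rewrite /v mS.
by apply: amsgrad_coord_step => //; rewrite a_noninc a_ge0.
Qed.

(** Indices follow the states of the recursion: a n and m n stand for A_(n-1) and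
m_(n-1), ga n for gamma_(n+1), v n for the displacement that leads to iterate n.
As 0.-1 = 0, the increment ga n.-1 - ga n vanishes at n = 0. *)
Lemma amsgrad_pathwise N :
  (1 - rho) * \sum_(n < N) ga n * (\sum_i h n i * a n i * g n i) <=
    ((f 0%N - fmin) + d%:R * (G ^+ 2 + G * a0 ^+ 2))
    + (2 * K * a0 ^+ 2 + G) * (\sum_(n < N) ga n ^+ 2 * (\sum_i m n.+1 i ^+ 2))
    + G * a0 * \sum_(n < N) (ga n.-1 - ga n) * (\sum_i (1 + m n i ^+ 2)).
Proof.
have [rho0 rho_le1] := andP rho01.
have rho1 : 0 <= 1 - rho by rewrite subr_ge0.
have vm n : \sum_i v n.+1 i ^+ 2 <= a0 ^+ 2 * (ga n ^+ 2 * \sum_i m n.+1 i ^+ 2).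
  rewrite !mulr_sumr; apply: ler_sum => i _; rewrite /v /= mulrA -exprMn -exprMn.
  rewrite [leLHS]exprMn [leRHS]exprMn ler_wpM2r ?sqr_ge0//.
  have aga : 0 <= ga n * a n.+1 i by rewrite mulr_ge0.
  rewrite ler_sqr ?nnegrE// ?mulr_ge0//; last exact: le_trans (a_ge0 0 i) (a_le 0 i).
  by rewrite mulrC ler_wpM2r.
(* The term - K |v_N|^2 is what step N - 1 sets aside to pay for the change of
   gradient in step N; G a0 (a_0 - a_N) is the telescoped change of step size. *)
have inv : (1 - rho) * \sum_(n < N) ga n * (\sum_i h n i * a n i * g n i) <=
    (1 - rho) * (f 0%N - f N) + rho * \sum_i h N.-1 i * v N i
    - K * \sum_i v N i ^+ 2 + G * a0 * (\sum_i a 0%N i - \sum_i a N i)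
    + (2 * K * a0 ^+ 2 + G) * (\sum_(n < N) ga n ^+ 2 * (\sum_i m n.+1 i ^+ 2))
    + G * a0 * \sum_(n < N) (ga n.-1 - ga n) * (\sum_i (1 + m n i ^+ 2)).
  elim: N => [|N IH].
    rewrite !big_ord0 !subrr !mulr0.
    by rewrite !big1 ?mulr0 ?addr0 ?subr0// => i _; rewrite v_init ?mulr0 ?expr0n.
  rewrite !big_ord_recr /= !mulrDr.
  have := step N; have := vm N.
  have := ler_wpM2l rho1 (f_descent N).
  have vN : 0 <= \sum_i v N.+1 i ^+ 2 by rewrite sumr_ge0// => i _; exact: sqr_ge0.
  have K0 : 0 <= K by apply: le_trans K_ge1.
  have := ler_wpM2l K0 (vm N).
  have : (1 - rho) * (K * \sum_i v N.+1 i ^+ 2) <= K * \sum_i v N.+1 i ^+ 2.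
    by rewrite ler_piMl ?mulr_ge0//; lra.
  move: IH.
  lra.
apply: le_trans inv _; rewrite !lerD2r.
have e1 : (1 - rho) * (f 0%N - f N) <= f 0%N - fmin.
  have [p|p] := lerP 0 (f 0%N - f N).
    apply: le_trans (_ : f 0%N - f N <= _); last by have := f_min N; lra.
    by rewrite ler_piMl//; lra.
  apply: le_trans (_ : 0 <= _); first by rewrite mulr_ge0_le0// ltW.
  by rewrite subr_ge0.
have e2 : rho * \sum_i h N.-1 i * v N i - K * \sum_i v N i ^+ 2 <= d%:R * G ^+ 2.
  rewrite !mulr_sumr -sumrB -[d in d%:R]card_ord mulr_natl -sumr_const.
  apply: ler_sum => i _.
  have h2 : h N.-1 i ^+ 2 <= G ^+ 2 by rewrite -real_normK ?num_real// ler_sqr ?nnegrE.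
  have := young_le (h N.-1 i) (v N i).
  have p1 := sqr_ge0 (v N i); have p2 := sqr_ge0 (h N.-1 i).
  have : v N i ^+ 2 <= K * v N i ^+ 2 by rewrite ler_peMl.
  have [p|p] := lerP 0 (h N.-1 i * v N i).
    have : rho * (h N.-1 i * v N i) <= h N.-1 i * v N i.
      by rewrite ler_piMl//; lra.
    lra.
  have : rho * (h N.-1 i * v N i) <= 0.
    by rewrite mulr_ge0_le0// ltW.
  lra.
have e3 : G * a0 * (\sum_i a 0%N i - \sum_i a N i) <= d%:R * (G * a0 ^+ 2).
  rewrite -sumrB mulr_sumr -[d in d%:R]card_ord mulr_natl -sumr_const.
  apply: ler_sum => i _; rewrite expr2 mulrA a_init.
  have a00 : 0 <= a0 by rewrite -(a_init i).
  by rewrite ler_wpM2l ?mulr_ge0// gerBl.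
lra.
Qed.

End pathwise.

(** * Sums of powers *)

Section sums.
Context {R : realType}.
Implicit Types (r s : R) (n N : nat).

(** This is ln (1 - x) <= - x at x = 1 / (n + 2), the only analytic input of the
comparisons of sums with powers and logarithms. *)
Lemma ln_natS n : ln n.+1%:R <= ln n.+2%:R - n.+2%:R^-1 :> R.
Proof.
have -> : n.+1%:R = n.+2%:R * (1 + - n.+2%:R^-1) :> R.
  rewrite mulrBr mulr1 divff ?pnatr_eq0//.
  by rewrite -(natrB _ (_ : 1 <= n.+2)%N)// subn1.
have y1 : 0 < 1 + - n.+2%:R^-1 :> R.
  by rewrite subr_gt0 invf_lt1// ltr1n.
rewrite lnM ?posrE// lerD2l; apply: le_ln1Dx.
by rewrite -subr_gt0 opprK addrC.
Qed.

Lemma powR_natE n r : n.+1%:R `^ r = expR (r * ln n.+1%:R).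
Proof. by rewrite /powR pnatr_eq0. Qed.

Lemma powRB1_nat n r : n.+1%:R `^ (r - 1) = n.+1%:R `^ r / n.+1%:R :> R.
Proof. by rewrite powRB ?pnatr_eq0 ?implybT// powRr1. Qed.

(** Discrete counterpart of the integral of x^(r - 1): with u = r / x, the
inequality exp (- u) <= 1 / (1 + u) gives
x^r - (x - 1)^r >= x^r u / (1 + u), and u <= r. *)
Lemma powR_increment r n : 0 < r ->
  n.+1%:R `^ (r - 1) * (r / (1 + r)) <= n.+1%:R `^ r - n%:R `^ r.
Proof.
move=> r0; have r1 : 0 < 1 + r by lra.
case: n => [|n].
  by rewrite !powR1 powR0 ?gt_eqF// subr0 mul1r ler_pdivrMr//; lra.
set x : R := n.+2%:R; have x0 : 0 < x by rewrite ltr0n.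
have x1 : 1 <= x by rewrite ler1n.
have P0 : 0 < x `^ r by rewrite powR_gt0.
pose u := r / x; have u0 : 0 < u by rewrite divr_gt0.
have ur : u <= r by rewrite ler_pdivrMr// ler_peMr// ltW.
have le1 : n.+1%:R `^ r <= x `^ r * (1 + u)^-1.
  apply: (@le_trans _ _ (x `^ r * expR (- u))).
    rewrite /x !powR_natE -expRD ler_expR /u -mulrN -mulrDr.
    by rewrite ler_pM2l// ln_natS.
  rewrite ler_pM2l// expRN lef_pV2 ?posrE ?expR_gt0 ?expR_ge1Dx//; lra.
rewrite /x powRB1_nat -/x.
have u1 : 0 < 1 + u by lra.
apply: (@le_trans _ _ (x `^ r - x `^ r * (1 + u)^-1)); last by rewrite lerD2l lerN2.
rewrite -[X in X - _]mulr1 -mulrBr -mulrA ler_pM2l//.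
have -> : 1 - (1 + u)^-1 = u / (1 + u) by field; lra.
have -> : x^-1 * (r / (1 + r)) = u / (1 + r) by rewrite /u; field; lra.
by rewrite ler_pM2l// lef_pV2 ?posrE// lerD2l.
Qed.

Lemma powR_decrement r n : r < 0 ->
  n.+2%:R `^ (r - 1) * (- r) <= n.+1%:R `^ r - n.+2%:R `^ r.
Proof.
move=> r0; rewrite powRB1_nat.
set x : R := n.+2%:R; have x0 : 0 < x by rewrite ltr0n.
have P0 : 0 < x `^ r by rewrite powR_gt0.
have le1 : x `^ r * (1 + - r / x) <= n.+1%:R `^ r.
  apply: (@le_trans _ _ (x `^ r * expR (- r / x))).
    by rewrite ler_pM2l// expR_ge1Dx.
  rewrite /x !powR_natE -expRD ler_expR mulNr -mulrN -mulrDr.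
  by rewrite ler_nM2l// ln_natS.
by rewrite lerBrDl (le_trans _ le1)// mulrDr mulr1 mulNr mulrN mulrN mulrA mulrAC.
Qed.

Let psum s N : R := \sum_(n < N) n.+1%:R `^ (- s).

Lemma psum_lt1 s N : s < 1 -> psum s N <= (1 + (1 - s)) / (1 - s) * N%:R `^ (1 - s).
Proof.
move=> s1; set r := 1 - s; have r0 : 0 < r by rewrite subr_gt0.
have k0 : 0 < r / (1 + r) by rewrite divr_gt0//; lra.
have -> : (1 + r) / r = (r / (1 + r))^-1 by rewrite invf_div.
rewrite mulrC ler_pdivlMr//; elim: N => [|N IH].
  by rewrite /psum big_ord0 mul0r powR_ge0.
rewrite /psum big_ord_recr /= mulrDl.
have := powR_increment N r0; rewrite (_ : r - 1 = - s); last by rewrite /r; ring.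
move: IH; rewrite /psum; lra.
Qed.

Lemma psum_eq1 N : psum 1 N.+1 <= 1 + ln N.+1%:R.
Proof.
elim: N => [|N IH]; first by rewrite /psum big_ord1 ln1 addr0 powR1.
rewrite /psum big_ord_recr /= powR_inv1//.
have := ln_natS N; move: IH; rewrite /psum; move: (N.+2%:R^-1) => y; lra.
Qed.

Lemma psum_gt1 s N : 1 < s -> psum s N.+1 <= 1 + (s - 1)^-1.
Proof.
move=> s1; have r0 : 1 - s < 0 by lra.
apply: (@le_trans _ _ (1 + (s - 1)^-1 * (1 - N.+1%:R `^ (1 - s)))); last first.
  rewrite lerD2l ler_piMr ?gerBl ?powR_ge0// invr_ge0; lra.
elim: N => [|N IH]; first by rewrite /psum big_ord1 !powR1 subrr mulr0 addr0.
rewrite /psum big_ord_recr /=.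
have := powR_decrement N r0.
rewrite (_ : 1 - s - 1 = - s); last by ring.
rewrite (_ : - (1 - s) = s - 1); last by ring.
rewrite -ler_pdivlMr; last by lra.
move: IH; rewrite /psum; lra.
Qed.

Lemma ln_natS_le2 N : (2 <= N)%N -> ln N.+1%:R <= 2 * ln N%:R :> R.
Proof.
move=> N2; have N0 : 0 < N%:R :> R by rewrite ltr0n (leq_trans _ N2).
have -> : 2 * ln N%:R = ln (N%:R ^+ 2) :> R by rewrite lnXn// mulr_natl.
rewrite ler_ln ?posrE ?exprn_gt0// -natrX ler_nat.
by case: N N2 {N0} => [|[|N]]// _; rewrite !expnS expn0; nia.
Qed.

Lemma ln_nat_ge2 N : (2 <= N)%N -> ln 2 <= ln N%:R :> R.
Proof. by move=> N2; rewrite ler_ln ?posrE ?ltr0n ?ler_nat// (leq_trans _ N2). Qed.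

Lemma ln2_gt0 : 0 < ln 2 :> R.
Proof. by rewrite ln_gt0// ltr1n. Qed.

Lemma log_factor_le N : (2 <= N)%N ->
  1 + ln N.+1%:R <= ((ln 2)^-1 + 2) * ln N%:R :> R.
Proof.
move=> N2; rewrite mulrDl lerD ?ln_natS_le2//.
by rewrite mulrC ler_pdivlMr ?ln2_gt0// mul1r ln_nat_ge2.
Qed.

Lemma powR_natS_le r N : 0 <= r -> (1 <= N)%N ->
  N.+1%:R `^ r <= 2 `^ r * N%:R `^ r.
Proof.
move=> r0 N1; rewrite -powRM// ge0_ler_powR ?nnegrE// ?mulr_ge0//.
by rewrite -natrM ler_nat; lia.
Qed.

Lemma Psi_ge0 s N : (2 <= N)%N -> 0 <= Psi N s.
Proof.
move=> N2; rewrite /Psi; case: ifP => _; first exact: powR_ge0.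
by case: ifP => // _; rewrite ln_ge0// ler1n (leq_trans _ N2).
Qed.

Lemma Phi_ge0 s N : (2 <= N)%N -> 0 <= Phi N s.
Proof.
have ln0 : (2 <= N)%N -> 0 <= ln N%:R :> R.
  by move=> N2; rewrite ln_ge0// ler1n (leq_trans _ N2).
move=> N2; rewrite /Phi; case: ifP => _; first by rewrite mulr_ge0 ?powR_ge0 ?ln0.
by case: ifP => // _; rewrite exprn_ge0// ln0.
Qed.

Lemma sum_powR_Psi s : exists2 C, 0 <= C & forall N, (2 <= N)%N ->
  \sum_(n < N.+1) n.+1%:R `^ (- s) <= C * (1 + Psi N s).
Proof.
rewrite /Psi; have [s1|s1|->] := ltgtP s 1.
- pose r := 1 - s; have r0 : 0 < r by rewrite subr_gt0.
  have k0 : 0 <= (1 + r) / r by rewrite divr_ge0//; lra.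
  exists ((1 + r) / r * 2 `^ r); first by rewrite mulr_ge0 ?powR_ge0.
  move=> N N2; apply: le_trans (psum_lt1 _ s1) _; rewrite -/r -[leRHS]mulrA.
  rewrite ler_wpM2l//.
  apply: le_trans (powR_natS_le (ltW r0) (ltnW N2)) _.
  by rewrite ler_wpM2l ?powR_ge0// lerDr.
- exists (1 + (s - 1)^-1); first by rewrite addr_ge0// invr_ge0; lra.
  move=> N N2; apply: le_trans (psum_gt1 _ s1) _.
  have : 0 <= (s - 1)^-1 by rewrite invr_ge0; lra.
  lra.
- exists 2 => // N N2; apply: le_trans (psum_eq1 _) _.
  have := ln_natS_le2 N2; lra.
Qed.

Lemma ln_le_powR n r : 0 < r -> ln n.+1%:R <= r^-1 * n.+1%:R `^ r :> R.
Proof.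
move=> r0; rewrite mulrC ler_pdivlMr// mulrC -ln_powR.
by rewrite ltW// ln_sublinear// powR_gt0.
Qed.

(** For s > 1 the logarithm is absorbed in a small power of n, chosen so that the
exponent stays above 1; for s <= 1 it is bounded by its last value. *)
Lemma sum_powR_ln_Phi s : exists2 C, 0 <= C & forall N, (2 <= N)%N ->
  \sum_(n < N.+1) n.+1%:R `^ (- s) * (1 + ln n.+1%:R) <= C * (1 + Phi N s).
Proof.
have [s1|s1] := lerP s 1; last first.
  pose e := (s - 1) / 2; have e0 : 0 < e by rewrite divr_gt0//; lra.
  have [C C0 HC] := sum_powR_Psi (s - e).
  have ei : 0 <= e^-1 by rewrite invr_ge0 ltW.
  exists ((1 + e^-1) * C); first by rewrite mulr_ge0//; lra.
  move=> N N2; rewrite -mulrA.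
  have -> : Phi N s = Psi N (s - e).
    rewrite /Phi /Psi !ifF//; first by apply/negbTE; rewrite gt_eqF// /e; lra.
    - by apply/negbTE; rewrite -leNgt /e; lra.
    - by apply/negbTE; rewrite gt_eqF.
    - by apply/negbTE; rewrite -leNgt ltW.
  apply: le_trans (ler_wpM2l _ (HC N N2)); last by lra.
  rewrite mulr_sumr; apply: ler_sum => n _.
  have -> : n.+1%:R `^ (- (s - e)) = n.+1%:R `^ (- s) * n.+1%:R `^ e.
    by rewrite -powRD ?pnatr_eq0 ?implybT//; congr powR; ring.
  rewrite mulrCA ler_wpM2l ?powR_ge0// mulrDl mul1r.
  rewrite lerD ?ln_le_powR// -[leLHS](powRr0 n.+1%:R) ler_powR ?ler1n//.
  exact: ltW.
have [C C0 HC] := sum_powR_Psi s.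
pose c : R := (ln 2)^-1 + 2.
have c0 : 0 <= c by rewrite addr_ge0// invr_ge0 ltW// ln2_gt0.
have main N : (2 <= N)%N -> \sum_(n < N.+1) n.+1%:R `^ (- s) * (1 + ln n.+1%:R)
    <= (c * ln N%:R) * (C * (1 + Psi N s)).
  move=> N2; have l0 : 0 <= ln N.+1%:R :> R by rewrite ln_ge0 ?ler1n.
  apply: (@le_trans _ _ ((1 + ln N.+1%:R) * (C * (1 + Psi N s)))).
    apply: le_trans (ler_wpM2l _ (HC N N2)); last by lra.
    rewrite mulr_sumr; apply: ler_sum => n _.
    rewrite mulrC ler_wpM2r ?powR_ge0// lerD2l ler_ln ?posrE//.
    by rewrite ler_nat ltn_ord.
  rewrite ler_wpM2r ?log_factor_le// mulr_ge0//.
  by have := Psi_ge0 s N2; lra.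
have [s1'|s1'] := eqVneq s 1.
  exists (c * C * c); first by rewrite !mulr_ge0.
  move=> N N2; apply: le_trans (main N N2) _.
  rewrite /Psi /Phi s1' ltxx eqxx.
  have l0 : 0 <= ln N%:R :> R by rewrite ln_ge0// ler1n (leq_trans _ N2).
  have l2 : 1 + ln N%:R <= c * ln N%:R.
    apply: le_trans (log_factor_le N2).
    by rewrite lerD2l ler_ln ?posrE ?ltr0n ?ler_nat// (leq_trans _ N2).
  apply: (@le_trans _ _ ((c * ln N%:R) * (C * (c * ln N%:R)))).
    by rewrite ler_wpM2l ?mulr_ge0// ler_wpM2l.
  have : 0 <= c * C * c by rewrite !mulr_ge0.
  lra.
exists (c * C * 2); first by rewrite !mulr_ge0.
move=> N N2; apply: le_trans (main N N2) _.
have s1'' : s < 1 by rewrite lt_neqAle s1'.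
rewrite /Psi /Phi s1''.
have l0 : 0 <= ln N%:R :> R by rewrite ln_ge0// ler1n (leq_trans _ N2).
have p1 : 1 <= N%:R `^ (1 - s).
  rewrite -[leLHS](powRr0 N%:R) ler_powR//; last by lra.
  by rewrite ler1n (leq_trans _ N2).
apply: (@le_trans _ _ ((c * ln N%:R) * (C * (2 * N%:R `^ (1 - s))))).
  rewrite ler_wpM2l ?mulr_ge0// ler_wpM2l//; lra.
have : 0 <= c * C by rewrite !mulr_ge0.
lra.
Qed.

End sums.

(** * Integrals of discretised functions *)

Section floor_grid.
Context {R : realType}.
Implicit Types x : R.

(** Rounding down to a multiple of 1 / (k + 1): it takes finitely many values on
a bounded set and its fibres are measurable, which is how both bounded
measurable functions and vector arguments are discretised below. *)
Definition grid (k : nat) x : R := (Num.floor (k.+1%:R * x))%:~R / k.+1%:R.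

Lemma grid_error k x : `|x - grid k x| <= k.+1%:R^-1.
Proof.
have k0 : 0 < k.+1%:R :> R by rewrite ltr0n.
have {1}-> : x = k.+1%:R * x / k.+1%:R by rewrite mulrAC mulfV ?mul1r ?gt_eqF.
rewrite -mulrBl normrM normfV (ger0_norm (ltW k0)) ler_piMl ?invr_ge0//.
have /andP[l1] := floor_itv (k.+1%:R * x); rewrite intrD => /ltW l2.
by rewrite ger0_norm ?subr_ge0// lerBlDl.
Qed.

Lemma measurable_floor_fiber k (z : int) :
  measurable [set x : R | Num.floor (k.+1%:R * x) = z].
Proof.
have -> : [set x : R | Num.floor (k.+1%:R * x) = z] =
    [set: R] `&` ( *%R k.+1%:R) @^-1` `[z%:~R, (z + 1)%:~R[%classic.
  apply/seteqP; split => x /=; rewrite in_itv /= -floor_eq.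
    by move=> ->; rewrite eqxx.
  by move=> [_ /eqP].
by apply: mulrl_measurable => //; exact: measurable_itv.
Qed.

End floor_grid.

Section integrals.
Context {dO : measure_display} {Omega : measurableType dO} {R : realType}.
Variable P : probability Omega R.
Implicit Types f g D u : Omega -> R.

Local Notation E f := (Rintegral P setT f).
Local Notation L1 f := (P.-integrable [set: Omega] (EFin \o f)).

Lemma L1_measurable f : L1 f -> measurable_fun setT f.
Proof. by move=> /measurable_int /measurable_EFinP. Qed.

Lemma L1_le f g : measurable_fun setT f -> (forall w, `|f w| <= g w) ->
  L1 g -> L1 f.
Proof.
move=> mf fg; apply: le_integrable => //; first exact/measurable_EFinP.
by move=> w _ /=; rewrite lee_fin (le_trans (fg w)) ?ler_norm.
Qed.

Lemma L1_cst (c : R) : L1 (fun=> c).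
Proof. exact: (@finite_measure_integrable_cst _ _ _ P setT). Qed.

Lemma L1_bounded f M : measurable_fun setT f -> (forall w, `|f w| <= M) -> L1 f.
Proof. by move=> mf fM; exact: (L1_le mf fM (L1_cst M)). Qed.

Lemma L1D f g : L1 f -> L1 g -> L1 (fun w => f w + g w).
Proof. by move=> lf lg; exact: (integrableD _ lf lg). Qed.

Lemma L1B f g : L1 f -> L1 g -> L1 (fun w => f w - g w).
Proof. by move=> lf lg; exact: (integrableB _ lf lg). Qed.

Lemma L1Z (c : R) f : L1 f -> L1 (fun w => c * f w).
Proof. by move=> lf; exact: (integrableZl _ c lf). Qed.

Lemma L1_sum I (s : seq I) (F : I -> Omega -> R) :
  (forall i, L1 (F i)) -> L1 (fun w => \sum_(i <- s) F i w).
Proof.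
move=> lF; elim: s => [|i s IH].
  by under eq_fun do rewrite big_nil; exact: L1_cst.
by under eq_fun do rewrite big_cons; exact: L1D.
Qed.

Lemma L1_mul_bounded f u M : L1 f -> measurable_fun setT u ->
  (forall w, `|u w| <= M) -> L1 (fun w => f w * u w).
Proof.
move=> lf mu uM; apply: (@L1_le _ (fun w => M * `|f w|)).
- by apply: measurable_funM => //; exact: L1_measurable.
- by move=> w; rewrite normrM mulrC ler_wpM2r.
- exact/L1Z/integrable_norm.
Qed.

Lemma L1_indic (A : set Omega) : measurable A -> L1 (\1_A : Omega -> R).
Proof. by move=> mA; exact: integrable_indic. Qed.

Lemma E_cst (c : R) : E (fun=> c) = c.
Proof. by rewrite Rintegral_cst// [X in fine X]probability_setT mulr1. Qed.

Lemma E_sum I (s : seq I) (F : I -> Omega -> R) :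
  (forall i, L1 (F i)) -> E (fun w => \sum_(i <- s) F i w) = \sum_(i <- s) E (F i).
Proof.
move=> lF; elim: s => [|i s IH].
  by rewrite big_nil; under eq_Rintegral do rewrite big_nil; exact: E_cst.
rewrite big_cons; under eq_Rintegral do rewrite big_cons.
by rewrite RintegralD// ?IH//; exact: L1_sum.
Qed.

Lemma E_le f g : L1 f -> L1 g -> (forall w, f w <= g w) -> E f <= E g.
Proof. by move=> lf lg fg; apply: le_Rintegral. Qed.

Lemma E_le_ae f g : L1 f -> L1 g -> {ae P, forall w, f w <= g w} -> E f <= E g.
Proof.
move=> lf lg fg; pose h w := Num.max (g w - f w) 0.
have mgf := L1_measurable (L1B lg lf).
have -> : E g = E f + E (fun w => g w - f w) by rewrite RintegralB// addrC subrK.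
rewrite lerDl.
have -> : E (fun w => g w - f w) = E h.
  congr fine; apply: ae_eq_integral => //; first exact/measurable_EFinP.
    by apply/measurable_EFinP/measurable_maxr.
  apply: filterS fg => w fgw _; congr EFin.
  by rewrite /h max_l// subr_ge0.
by apply: Rintegral_ge0 => w _; rewrite le_max lexx orbT.
Qed.

Lemma E_indic D (A : set Omega) : measurable A ->
  E (fun w => D w * \1_A w) = \int[P]_(w in A) D w.
Proof.
move=> mA; rewrite [RHS]Rintegral_mkcond; apply: eq_Rintegral => w _.
by rewrite patchE indicE; case: (w \in A); rewrite ?mulr1 ?mulr0.
Qed.

(** The form in which conditional expectations are used: a random variable whose
integral vanishes on every event of F is orthogonal to every bounded
F-measurable u. Rounding u to a grid of mesh 1 / (k + 1) replaces it by a finite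
combination of indicators of events of F, with an error of at most
E|D| / (k + 1). *)
Lemma E_mul_eq0 (F : set (set Omega)) D u M :
  (forall A, F A -> measurable A) ->
  L1 D -> (forall A, F A -> \int[P]_(w in A) D w = 0) ->
  measurable_wrt F u -> (forall w, `|u w| <= M) ->
  E (fun w => D w * u w) = 0.
Proof.
move=> Fm lD D0 uF uM.
have mu : measurable_fun setT u by move=> _ B mB; rewrite setTI; exact/Fm/uF.
pose W : R := E (fun w => `|D w|).
have lDn : L1 (fun w => `|D w|) by exact: integrable_norm.
have W0 : 0 <= W by apply: Rintegral_ge0.
have lDu := L1_mul_bounded lD mu uM.
suff main k : `|E (fun w => D w * u w)| <= W * k.+1%:R^-1.
  apply/eqP; rewrite -normr_le0 leNgt; apply/negP => e0.
  pose k := Num.truncn (W / `|E (fun w => D w * u w)|).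
  have := main k; rewrite ler_pdivlMr ?ltr0n// leNgt => /negP; apply.
  by rewrite mulrC -ltr_pdivrMr// truncnS_gt.
pose A z := u @^-1` [set x : R | Num.floor (k.+1%:R * x) = z].
have FA z : F (A z) by apply: uF; exact: measurable_floor_fiber.
have mA z := Fm _ (FA z).
(* All values of floor ((k + 1) u) lie in [-b, b[ as |u| <= M. *)
pose b := (Num.truncn (k.+1%:R * M)).+2.
pose zs : seq int := [seq j%:Z - b%:Z | j <- iota 0 (b + b)].
have zs_uniq : uniq zs.
  by rewrite map_inj_uniq ?iota_uniq// => i j /(can_inj (subrK _)) [].
have zsP w : Num.floor (k.+1%:R * u w) \in zs.
  have kM : `|k.+1%:R * u w| < (Num.truncn (k.+1%:R * M)).+1%:R.
    by rewrite normrM ger0_norm// (le_lt_trans _ (truncnS_gt _))// ler_wpM2l.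
  have : (- b%:Z <= Num.floor (k.+1%:R * u w) < b%:Z).
    rewrite floor_ge_int floor_lt_int.
    move: kM; rewrite ltr_norml mulrNz -!pmulrn /b => /andP[k1 k2].
    by rewrite (le_trans _ (ltW k1)) ?lerN2 ?ler_nat// (lt_trans k2)// ltr_nat.
  set z := Num.floor _ => /andP[z1 z2].
  apply/mapP; exists `|(z + b%:Z)%R|%N; first by rewrite mem_iota /= add0n; lia.
  by rewrite gez0_abs ?addrK// -[X in X <= _](addNr b%:Z) lerD2r.
pose U w := \sum_(z <- zs) (z%:~R / k.+1%:R) * \1_(A z) w : R.
have UE w : U w = grid k (u w).
  rewrite /U (bigD1_seq (Num.floor (k.+1%:R * u w)))//=.
  rewrite indicE mem_set// mulr1 big1 ?addr0// => z /negPf zw.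
  by rewrite indicE memNset ?mulr0//= => /esym/eqP; rewrite /A /= zw.
have lDA z : L1 (fun w => D w * \1_(A z) w).
  apply: (@L1_mul_bounded _ _ 1) => // w.
  by rewrite indicE; case: (_ \in _); rewrite ?normr1 ?normr0.
have lDU : L1 (fun w => D w * U w).
  under eq_fun do rewrite /U mulr_sumr.
  apply: L1_sum => z; under eq_fun do rewrite mulrCA; exact: L1Z.
have EDU : E (fun w => D w * U w) = 0.
  under eq_Rintegral do rewrite /U mulr_sumr.
  rewrite E_sum; last by move=> z; under eq_fun do rewrite mulrCA; exact: L1Z.
  apply: big1 => z _; under eq_Rintegral do rewrite mulrCA.
  by rewrite RintegralZl// E_indic// D0// mulr0.
rewrite -[E _]subr0 -EDU -RintegralB//.
have lB := L1B lDu lDU.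
apply: le_trans (le_normr_Rintegral _ _) _ => //.
rewrite /W -RintegralZr//; apply: E_le => //; first exact: integrable_norm.
  by under eq_fun do rewrite mulrC; exact: L1Z.
by move=> w; rewrite -mulrBr normrM UE ler_wpM2l// grid_error.
Qed.

End integrals.

Section measurable_vectors.
Context {dT : measure_display} {T : measurableType dT} {R : realType} {d : nat}.

Lemma enorm_le_coord (v : 'cV[R]_d) (c : R) : 0 <= c ->
  (forall i, `|v i 0| <= c) -> enorm v <= Num.sqrt d%:R * c.
Proof.
move=> c0 vc; rewrite -[c in leRHS]ger0_norm// -sqrtr_sqr -sqrtrM ?ler0n//.
rewrite ler_wsqrtr// -[d in d%:R]card_ord mulr_natl -sumr_const.
by apply: ler_sum => i _; rewrite -real_normK ?num_real// ler_sqr ?nnegrE.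
Qed.

(** A vector with measurable coordinates, rounded to a grid, takes countably many
values on measurable sets, so any function of it is measurable; the Lipschitz
bound makes these functions converge pointwise as the grid is refined. *)
Lemma measurable_lipschitz_comp (f : 'cV[R]_d -> R) (L : R) (Y : T -> 'cV[R]_d) :
  0 <= L ->
  (forall x y, `|f x - f y| <= L * enorm (x - y)) ->
  (forall i, measurable_fun setT (fun w => Y w i 0)) ->
  measurable_fun setT (f \o Y).
Proof.
move=> L0 fL mY.
pose q k w : 'cV[int]_d := \col_i Num.floor (k.+1%:R * Y w i 0).
pose e k (z : 'cV[int]_d) : 'cV[R]_d := \col_i ((z i 0)%:~R / k.+1%:R).
apply: (measurable_fun_cvg (h := fun k w => f (e k (q k w)))).
  move=> k _ B mB; rewrite setTI.
  have -> : (fun w => f (e k (q k w))) @^-1` B =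
      \bigcup_(z in [set z | B (f (e k z))])
        \bigcap_(i in [set: 'I_d]) [set w | Num.floor (k.+1%:R * Y w i 0) = z i 0].
    apply/seteqP; split => [w /= Bw|w /= [z Bz zw]].
      by exists (q k w) => // i _ /=; rewrite !mxE.
    rewrite (_ : q k w = z)//; apply/matrixP => i j; rewrite !mxE ord1.
    exact: zw.
  rewrite bigcup_mkcond; apply: countable_bigcupT_measurable; first exact: countableP.
  move=> z.
  case: ifPn => // _; apply: fin_bigcap_measurable => // i _.
  have := mY i measurableT _ (measurable_floor_fiber k (z i 0)).
  by rewrite setTI.
move=> w _; apply/cvgrPdist_le => eps e0; near=> k.
apply: le_trans (fL _ _) _.
apply: (@le_trans _ _ (L * (Num.sqrt d%:R * k.+1%:R^-1))).
  rewrite ler_wpM2l// enorm_le_coord ?invr_ge0// => i.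
  by have := grid_error k (Y w i 0); rewrite !mxE.
rewrite mulrA ler_pdivrMr ?ltr0n// -ler_pdivrMl// mulrC.
rewrite (le_trans (ltW (truncnS_gt _)))// ler_nat ltnS.
by near: k; exact: nbhs_infty_ge.
Unshelve. all: by end_near. Qed.

End measurable_vectors.

(** * The AMSGrad recursion *)

Lemma mean_field_coord_le (R : realType) (d : nat) (dX : measure_display)
    (X : measurableType dX) (pi : probability X R) (H : X -> 'cV[R]_d) (G : R)
    (i : 'I_d) :
  measurable_vec H -> (supnorm H <= G%:E)%E -> `|mean_field pi H i 0| <= G.
Proof.
move=> mH HG; rewrite mxE.
have HGx x : `|H x i 0| <= G.
  apply: le_trans (coord_le_enorm _ _) _; rewrite -lee_fin.
  by apply: le_trans HG; apply: ereal_sup_ubound; exists x.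
have lH := L1_bounded pi (mH i) HGx.
apply: le_trans (le_normr_Rintegral measurableT lH) _.
rewrite -[leRHS](E_cst pi G); apply: E_le => //; first exact: integrable_norm.
exact: L1_cst.
Qed.

Section run.
Context {R : realType} {d : nat}.
Variables (rho1 rho2 delta : R) (gam eps : nat -> R) (theta0 : 'cV[R]_d).

Local Notation st est n := (amsgrad rho1 rho2 delta gam eps theta0 est n).
Local Notation a est n i := (Num.sqrt (delta + as_What (st est n) i i))^-1.

Local Notation a0 := (Num.sqrt delta)^-1.

Section one_run.
Variable est : nat -> 'cV[R]_d -> 'cV[R]_d.
Let g n := est n.+1 (as_theta (st est n)).

Lemma amsgrad_mS n i : as_m (st est n.+1) i 0 =
  rho1 * as_m (st est n) i 0 + (1 - rho1) * g n i 0.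
Proof. by rewrite /= !mxE. Qed.

Lemma amsgrad_thetaS n i : as_theta (st est n.+1) i 0 =
  as_theta (st est n) i 0 - gam n.+1 * a est n.+1 i * as_m (st est n.+1) i 0.
Proof. by rewrite /= mul_diag_mx !mxE eqxx !mulr1n mulrA. Qed.

Lemma amsgrad_WS n i : as_W (st est n.+1) i i = rho2 * as_W (st est n) i i +
  (1 - rho2) * Num.min (eps n.+1) (g n i 0 ^+ 2).
Proof. by rewrite /= !mxE eqxx !mulr1n big_ord1 !mxE. Qed.

Lemma amsgrad_WhatS n i : as_What (st est n.+1) i i =
  Num.max (as_What (st est n) i i) (as_W (st est n.+1) i i).
Proof. by rewrite /= !mxE eqxx mulr1n. Qed.

Lemma amsgrad_What_ge0 n i : 0 <= as_What (st est n) i i.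
Proof.
by elim: n => [|n IH]; [rewrite /= mxE|rewrite amsgrad_WhatS le_max IH].
Qed.

Hypothesis rho2_01 : 0 <= rho2 < 1.
Hypothesis eps_gt0 : forall n, (1 <= n)%N -> 0 < eps n.
Hypothesis eps_nondec : forall m n, (1 <= m <= n)%N -> eps m <= eps n.
Hypothesis delta_gt0 : 0 < delta.

Lemma amsgrad_clip_mono n :
  eps n * (1 - rho2 ^+ n) <= eps n.+1 * (1 - rho2 ^+ n).
Proof.
have /andP[r0 r1] := rho2_01.
case: n => [|n]; first by rewrite expr0 subrr !mulr0.
by rewrite ler_wpM2r ?eps_nondec ?leqnSn// subr_ge0 exprn_ile1// ltW.
Qed.

(** A moving average of terms clipped at eps_1 <= ... <= eps_n, started from 0,
carries the total weight 1 - rho2^n; this is where ueps comes from. *)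
Lemma amsgrad_W_le n i : as_W (st est n) i i <= eps n * (1 - rho2 ^+ n).
Proof.
have /andP[r0 r1] := rho2_01.
elim: n => [|n IH]; first by rewrite /= mxE expr0 subrr mulr0.
rewrite amsgrad_WS.
have e1 := ler_wpM2l r0 (le_trans IH (amsgrad_clip_mono n)).
have e2 : (1 - rho2) * Num.min (eps n.+1) (g n i 0 ^+ 2) <= (1 - rho2) * eps n.+1.
  by rewrite ler_wpM2l ?ge_min ?lexx// subr_ge0 ltW.
rewrite [rho2 ^+ n.+1]exprS; lra.
Qed.

Lemma amsgrad_What_le n i : as_What (st est n) i i <= eps n * (1 - rho2 ^+ n).
Proof.
have /andP[r0 r1] := rho2_01.
elim: n => [|n IH]; first by rewrite /= mxE expr0 subrr mulr0.
rewrite amsgrad_WhatS ge_max amsgrad_W_le andbT (le_trans IH)//.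
apply: le_trans (amsgrad_clip_mono n) _.
rewrite (ler_wpM2l (ltW (eps_gt0 (ltn0Sn n))))// lerD2l lerN2 exprS.
by rewrite ler_piMl ?exprn_ge0// ltW.
Qed.

Let delta_What n i : 0 < delta + as_What (st est n) i i.
Proof. by rewrite ltr_pwDl// amsgrad_What_ge0. Qed.

Lemma amsgrad_step_size_ge n i : ueps delta rho2 eps n <= a est n i.
Proof.
case: n => [|n]; first by rewrite /ueps invr_ge0 sqrtr_ge0.
rewrite /ueps lef_pV2 ?posrE ?sqrtr_gt0 ?delta_What//.
  by rewrite ler_wsqrtr// lerD2l amsgrad_What_le.
by rewrite (lt_le_trans (delta_What n.+1 i))// lerD2l amsgrad_What_le.
Qed.

Lemma amsgrad_step_size_noninc n i : a est n.+1 i <= a est n i.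
Proof.
rewrite lef_pV2 ?posrE ?sqrtr_gt0 ?delta_What// ler_wsqrtr// lerD2l.
by rewrite amsgrad_WhatS le_max lexx.
Qed.

Lemma amsgrad_step_size_init i : a est 0 i = (Num.sqrt delta)^-1.
Proof. by rewrite /= mxE addr0. Qed.

Lemma amsgrad_step_size_le n i : a est n i <= (Num.sqrt delta)^-1.
Proof.
elim: n => [|n IH]; first by rewrite amsgrad_step_size_init.
exact: le_trans (amsgrad_step_size_noninc n i) IH.
Qed.

Lemma amsgrad_run_pathwise (V : 'cV[R]_d -> R) (L G Vmin : R) N :
  0 <= rho1 < 1 ->
  (forall n, (1 <= n)%N -> 0 < gam n) ->
  (forall m n, (1 <= m <= n)%N -> gam n <= gam m) ->
  (forall x, Vmin <= V x) ->
  (forall x, differentiable V x) ->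
  (forall x y, enorm (grad V x - grad V y) <= L * enorm (x - y)) ->
  0 <= G -> (forall x i, `|grad V x i 0| <= G) ->
  (1 - rho1) * \sum_(n < N) gam n.+1 *
     (\sum_i grad V (as_theta (st est n)) i 0 * a est n i * g n i 0) <=
    ((V theta0 - Vmin) + d%:R * (G ^+ 2 + G * a0 ^+ 2))
    + (2 * (L ^+ 2 + 1) * a0 ^+ 2 + G) *
      (\sum_(n < N) gam n.+1 ^+ 2 * (\sum_i as_m (st est n.+1) i 0 ^+ 2))
    + G * a0 * \sum_(n < N) (gam n.-1.+1 - gam n.+1) *
        (\sum_i (1 + as_m (st est n) i 0 ^+ 2)).
Proof.
move=> /andP[r0 r1] gam_gt0 gam_noninc Vm dV LV G0 hG.
pose v n : 'cV[R]_d := \col_i (gam n.+1 * a est n.+1 i * as_m (st est n.+1) i 0).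
have vE n i : v n i 0 = gam n.+1 * a est n.+1 i * as_m (st est n.+1) i 0.
  by rewrite mxE.
have thS n : as_theta (st est n.+1) = as_theta (st est n) - v n.
  by apply/matrixP => i j; rewrite ord1 amsgrad_thetaS !mxE.
apply: (@amsgrad_pathwise R d rho1 G a0 (L ^+ 2 + 1) Vmin
  (fun n => V (as_theta (st est n))) (fun n => gam n.+1)
  (fun n i => grad V (as_theta (st est n)) i 0) (fun n i => a est n i)
  (fun n i => g n i 0) (fun n i => as_m (st est n) i 0)) => //.
- by rewrite r0 ltW.
- by rewrite lerDr sqr_ge0.
- by move=> n; exact/ltW/gam_gt0.
- by move=> n; rewrite gam_noninc ?ltnS ?leqnSn.
- by move=> i; rewrite amsgrad_step_size_init.
- by move=> n i; exact: amsgrad_step_size_noninc.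
- by move=> i; rewrite /= mxE.
- by move=> n i; exact: amsgrad_mS.
- move=> n; rewrite thS; apply: le_trans (descent_step _ _ dV LV) _.
  by rewrite le_eqVlt; apply/orP; left; apply/eqP;
    congr (_ - _ + _ * _); apply: eq_bigr => i _; rewrite vE.
- move=> n.
  have uv := @enorm_lipschitz_sqr R d L _ _
    (LV (as_theta (st est n.+1)) (as_theta (st est n))).
  have gE (x y : 'cV[R]_d) i : (grad V x - grad V y) i 0 = grad V x i 0 - grad V y i 0.
    by move: (grad V x) (grad V y) => gx gy; rewrite !mxE.
  under eq_bigr do rewrite -gE.
  apply: le_trans uv _; rewrite le_eqVlt; apply/orP; left; apply/eqP.
  congr (_ * _); apply: eq_bigr => i _.
  by rewrite thS addrAC subrr sub0r mxE sqrrN vE.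
Qed.

End one_run.

(** The hypothesis bears on the estimators already evaluated at the iterates, as
the joint measurability of the estimator in its two arguments is not given. *)
Lemma amsgrad_measurable (dT : measure_display) (T : measurableType dT)
    (est : T -> nat -> 'cV[R]_d -> 'cV[R]_d) (N : nat) :
  0 < delta ->
  (forall n i, (n < N)%N -> measurable_fun [set: T]
    (fun w => est w n.+1 (as_theta (st (est w) n)) i 0)) ->
  forall n, (n <= N)%N ->
  [/\ forall i, measurable_fun [set: T] (fun w => as_theta (st (est w) n) i 0),
      forall i, measurable_fun [set: T] (fun w => as_m (st (est w) n) i 0),
      forall i, measurable_fun [set: T] (fun w => as_W (st (est w) n) i i),
      forall i, measurable_fun [set: T] (fun w => as_What (st (est w) n) i i) &
      forall i, measurable_fun [set: T] (fun w => a (est w) n i)].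
Proof.
move=> delta_gt0 mest n nN.
have ma k : (forall i, measurable_fun [set: T] (fun w => as_What (st (est w) k) i i)) ->
    forall i, measurable_fun [set: T] (fun w => a (est w) k i).
  move=> mW i; pose x w := delta + as_What (st (est w) k) i i.
  have -> : (fun w => a (est w) k i) = (@powR R ^~ (- 2^-1)) \o x.
    apply/funext => w /=; rewrite powRN powR12_sqrt// /x.
    by rewrite addr_ge0 ?amsgrad_What_ge0// ltW.
  by apply: measurableT_comp; [exact: measurable_powR|exact: measurable_funD].
elim: n nN => [_|n IH nN].
  have mWhat0 i : measurable_fun [set: T] (fun w => as_What (st (est w) 0) i i).
    by [].
  by split => // i; exact: ma.
have {IH} [mth mm mW mWhat _] := IH (ltnW nN).
have mS i : measurable_fun [set: T] (fun w => as_m (st (est w) n.+1) i 0).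
  under eq_fun do rewrite amsgrad_mS.
  by apply: measurable_funD; apply: measurable_funM => //; exact: mest.
have WS i : measurable_fun [set: T] (fun w => as_W (st (est w) n.+1) i i).
  under eq_fun do rewrite amsgrad_WS.
  apply: measurable_funD; apply: measurable_funM => //.
  by apply: measurable_minr => //; apply: measurable_funX; exact: mest.
have WhatS i : measurable_fun [set: T] (fun w => as_What (st (est w) n.+1) i i).
  by under eq_fun do rewrite amsgrad_WhatS; exact: measurable_maxr.
split => //; last by move=> i; exact: ma.
move=> i; under eq_fun do rewrite amsgrad_thetaS.
apply: measurable_funB => //; apply: measurable_funM => //.
by apply: measurable_funM => //; exact: ma.
Qed.

End run.

(** * AMSGrad with a biased stochastic gradient *)

Lemma measurable_wrtP (dO : measure_display) (Omega : measurableType dO)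
    (R : realType) (gen : set (set Omega)) (f : Omega -> R) :
  measurable_wrt <<s gen >> f <->
  measurable_fun [set: g_sigma_algebraType gen] (f : g_sigma_algebraType gen -> R).
Proof.
split=> [mf _ B mB|mf B mB]; first by rewrite setTI; exact: mf.
by have := mf measurableT B mB; rewrite setTI.
Qed.

Lemma measurable_wrtS (dO : measure_display) (Omega : measurableType dO)
    (R : realType) (F F' : set (set Omega)) (f : Omega -> R) :
  F `<=` F' -> measurable_wrt F f -> measurable_wrt F' f.
Proof. by move=> FF' mf B mB; exact/FF'/mf. Qed.

Section stochastic_amsgrad.
Context {R : realType} {d : nat} {dO : measure_display} {Omega : measurableType dO}.
Variable P : probability Omega R.
Variables (rho1 rho2 delta : R) (gam eps : nat -> R) (theta0 : 'cV[R]_d).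
Variable est : Omega -> nat -> 'cV[R]_d -> 'cV[R]_d.
Variable gen : nat -> set (set Omega).
Variables (V : 'cV[R]_d -> R) (L G Vmin : R) (b c : nat -> R).

Local Notation E f := (Rintegral P setT f).
Local Notation L1 f := (P.-integrable [set: Omega] (EFin \o f)).
Local Notation st w n := (amsgrad rho1 rho2 delta gam eps theta0 (est w) n).
Local Notation a w n i := (Num.sqrt (delta + as_What (st w n) i i))^-1.
Local Notation a0 := (Num.sqrt delta)^-1.
Local Notation F n := <<s gen n >>.
Let th n w := as_theta (st w n).
Let g n w := est w n.+1 (th n w).
Let h n w i : R := grad V (th n w) i 0.
Let q n w := \sum_i as_m (st w n) i 0 ^+ 2.

Hypothesis rho1_01 : 0 <= rho1 < 1.
Hypothesis rho2_01 : 0 <= rho2 < 1.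
Hypothesis delta_gt0 : 0 < delta.
Hypothesis gam_gt0 : forall n, (1 <= n)%N -> 0 < gam n.
Hypothesis gam_noninc : forall m n, (1 <= m <= n)%N -> gam n <= gam m.
Hypothesis eps_gt0 : forall n, (1 <= n)%N -> 0 < eps n.
Hypothesis eps_nondec : forall m n, (1 <= m <= n)%N -> eps m <= eps n.
Hypothesis V_min : forall x, Vmin <= V x.
Hypothesis V_diff : forall x, differentiable V x.
Hypothesis V_lip : forall x y, enorm (grad V x - grad V y) <= L * enorm (x - y).
Hypothesis G_ge0 : 0 <= G.
Hypothesis grad_le : forall x i, `|grad V x i 0| <= G.
Hypothesis gen_measurable : forall n A, F n A -> measurable A.
Hypothesis gen_mono : forall m n, (m <= n)%N -> F m `<=` F n.
Hypothesis est_adapted : forall n i, measurable_wrt (F n.+1) (fun w => g n w i 0).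
Hypothesis est_sqr_integrable : forall n, L1 (fun w => enorm (g n w) ^+ 2).
Hypothesis est_sqr_le : forall n, E (fun w => enorm (g n w) ^+ 2) <= b n.
Hypothesis b_ge0 : forall n, 0 <= b n.
Hypothesis b_nondec : forall n, b n <= b n.+1.
Hypothesis est_bias : forall n, exists2 Z : Omega -> 'cV[R]_d,
  is_condexp_vec P (F n) (g n) Z &
  {ae P, forall w, enorm (Z w - grad V (th n w)) <= c n}.

Lemma amsgrad_adapted n i : measurable_wrt (F n) (fun w => th n w i 0) /\
  measurable_wrt (F n) (fun w => a w n i).
Proof.
have [||mth _ _ _ ma] := @amsgrad_measurable R d rho1 rho2 delta gam eps theta0 _
    (g_sigma_algebraType (gen n)) est n delta_gt0 _ n; [|exact: leqnn|].
  move=> k j kn; apply/measurable_wrtP.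
  by apply: (measurable_wrtS _ (@est_adapted k j)); exact: gen_mono.
by split; apply/measurable_wrtP; [exact: mth|exact: ma].
Qed.

Lemma grad_adapted n i : measurable_wrt (F n) (fun w => h n w i).
Proof.
apply/measurable_wrtP.
apply: (@measurable_lipschitz_comp _ (g_sigma_algebraType (gen n)) R d
  (fun x => grad V x i 0) `|L| (th n)) => //.
  move=> x y; have gE : (grad V x - grad V y) i 0 = grad V x i 0 - grad V y i 0.
    by move: (grad V x) (grad V y) => gx gy; rewrite !mxE.
  rewrite -gE; apply: le_trans (coord_le_enorm _ _) _.
  by apply: le_trans (V_lip x y) _; rewrite ler_wpM2r ?enorm_ge0// ler_norm.
by move=> j; apply/measurable_wrtP; have [] := amsgrad_adapted n j.
Qed.

Let adapted_measurable n (f : Omega -> R) :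
  measurable_wrt (F n) f -> measurable_fun setT f.
Proof. by move=> mf _ B mB; rewrite setTI; apply: gen_measurable (mf _ mB). Qed.

Let mh n i : measurable_fun setT (fun w => h n w i).
Proof. exact: (adapted_measurable (@grad_adapted n i)). Qed.

Let ma n i : measurable_fun setT (fun w => a w n i).
Proof. by have [_] := amsgrad_adapted n i; exact: adapted_measurable. Qed.

Let mg n i : measurable_fun setT (fun w => g n w i 0).
Proof. exact: adapted_measurable (@est_adapted n i). Qed.

Let a_ge0 n w i : 0 <= a w n i.
Proof. by rewrite invr_ge0 sqrtr_ge0. Qed.

Let a_le n w i : a w n i <= a0.
Proof. exact: (amsgrad_step_size_le rho1 rho2 gam eps theta0 (est w) delta_gt0 n i). Qed.

Let Lg n i : L1 (fun w => g n w i 0).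
Proof. by have [Z + _] := est_bias n => /(_ i)[]. Qed.

Let Lh2 n i : L1 (fun w => h n w i ^+ 2).
Proof.
apply: (@L1_bounded _ _ _ _ _ (G ^+ 2)); first exact: measurable_funX.
by move=> w; rewrite normrX ler_sqr ?nnegrE// grad_le.
Qed.

Let ha_le n w i : `|h n w i * a w n i| <= G * a0.
Proof. by rewrite normrM (ger0_norm (a_ge0 _ _ _)) ler_pM// ?a_le// grad_le. Qed.

Let Lhag n i : L1 (fun w => h n w i * a w n i * g n w i 0).
Proof.
under eq_fun do rewrite mulrC.
by apply: (@L1_mul_bounded _ _ _ _ _ _ (G * a0)) => //; exact: measurable_funM.
Qed.

(** By convexity of the square, the squared momentum is at most the corresponding
moving average of squared estimators, and b is non-decreasing. *)
Lemma momentum_sqr_le n : L1 (q n) /\ E (q n) <= b n.-1.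
Proof.
have /andP[r0 r1] := rho1_01; have r1' : 0 <= 1 - rho1 by lra.
have mm k i : measurable_fun setT (fun w => as_m (st w k) i 0).
  have [||_ mm _ _ _] := @amsgrad_measurable R d rho1 rho2 delta gam eps theta0 _
    Omega est k delta_gt0 _ k; [|exact: leqnn|exact: mm].
  by move=> *; exact: mg.
elim: n => [|n [IL IE']].
  have -> : q 0 = fun=> 0.
    by apply/funext => w; rewrite /q big1// => i _; rewrite /= mxE expr0n.
  by split; [exact: L1_cst|rewrite E_cst].
have IE : E (q n) <= b n.
  by apply: le_trans IE' _; case: (n) => //= k; exact: b_nondec.
pose r w := rho1 * q n w + (1 - rho1) * enorm (g n w) ^+ 2.
have Lr : L1 r by apply: L1D; exact: L1Z.
have qr w : q n.+1 w <= r w.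
  rewrite /r enorm_sqr /q !mulr_sumr -big_split; apply: ler_sum => i _.
  rewrite -[leRHS]/(_ + _) amsgrad_mS -/(th n w) -/(g n w).
  move: (as_m _ _ _) (g n w i 0) => x y.
  have := mulr_ge0 (mulr_ge0 r0 r1') (sqr_ge0 (x - y)).
  lra.
have q_ge0 k w : 0 <= q k w by rewrite sumr_ge0// => i _; exact: sqr_ge0.
have Lq : L1 (q n.+1).
  apply: L1_le Lr => //.
    by apply: measurable_sum => i; exact: measurable_funX.
  by move=> w; rewrite ger0_norm.
split => //; apply: le_trans (E_le Lq Lr qr) _.
rewrite /r RintegralD//; [|exact: L1Z|exact: L1Z].
rewrite !RintegralZl//.
have e1 := ler_wpM2l r0 IE; have e2 := ler_wpM2l r1' (est_sqr_le n).
rewrite /=; lra.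
Qed.

(** State n carries A_(n-1), which is F_n-measurable; this is why g can be
replaced by its conditional expectation Z in each scalar product. *)
Lemma drift_le n : (forall k, 0 <= c k) ->
  ueps delta rho2 eps n * E (fun w => enorm (grad V (th n w)) ^+ 2)
    - d%:R * (a0 * G * c n) <=
  E (fun w => \sum_i h n w i * a w n i * g n w i 0).
Proof.
move=> c0; have [Z Zce Zb] := est_bias n.
under [X in _ * X - _]eq_Rintegral do rewrite enorm_sqr.
rewrite !E_sum//; last by move=> i; exact: Lh2.
rewrite mulr_sumr -[d in d%:R]card_ord mulr_natl -sumr_const -sumrB.
apply: ler_sum => i _; rewrite -RintegralZl//; last exact: Lh2.
have [_ LZ _ gZ] := Zce i.
pose u w := h n w i * a w n i.
have mu : measurable_fun setT u by exact: measurable_funM.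
have Fu : measurable_wrt (F n) u.
  apply/measurable_wrtP; apply: measurable_funM; apply/measurable_wrtP.
    exact: grad_adapted.
  by have [] := amsgrad_adapted n i.
have gZu : E (fun w => h n w i * a w n i * g n w i 0) = E (fun w => Z w i 0 * u w).
  under eq_Rintegral do rewrite mulrC.
  apply/eqP; rewrite -subr_eq0 -RintegralB//; last 2 first.
  - exact: (L1_mul_bounded (Lg n i) mu (ha_le n ^~ i)).
  - exact: (L1_mul_bounded LZ mu (ha_le n ^~ i)).
  under eq_Rintegral do rewrite -mulrBl.
  apply/eqP; apply: (E_mul_eq0 (gen_measurable (n := n)) (L1B (Lg n i) LZ) _ Fu
    (ha_le n ^~ i)).
  move=> A FA; have mA := gen_measurable FA.
  rewrite RintegralB//; [|exact: integrableS (Lg n i)|exact: integrableS LZ].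
  by apply/eqP; rewrite subr_eq0 /Rintegral gZ.
have LZu : L1 (fun w => Z w i 0 * u w) := L1_mul_bounded LZ mu (ha_le n ^~ i).
rewrite gZu -[X in _ - X](E_cst P) -RintegralB//; last 2 first.
- exact/L1Z/Lh2.
- exact: L1_cst.
apply: E_le_ae => //; first by apply: L1B; [exact/L1Z/Lh2|exact: L1_cst].
apply: filterS Zb => w Zw.
have Zi : `|Z w i 0 - h n w i| <= c n.
  apply: le_trans Zw; have := coord_le_enorm (Z w - grad V (th n w)) i.
  by rewrite /h; move: (grad V _) => gx; rewrite 2!mxE.
have Zu : - (G * a0 * c n) <= (Z w i 0 - h n w i) * u w.
  have : `|(Z w i 0 - h n w i) * u w| <= c n * (G * a0).
    by rewrite normrM ler_pM// ha_le.
  rewrite ler_norml => /andP[+ _]; lra.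
have ah : ueps delta rho2 eps n * h n w i ^+ 2 <= h n w i * u w.
  rewrite /u mulrA -expr2 mulrC ler_wpM2l ?sqr_ge0//.
  exact: (amsgrad_step_size_ge rho1 gam theta0 (est w) rho2_01 eps_gt0
    eps_nondec delta_gt0 n i).
move: Zu ah; rewrite -/(h n w i).
by move: (h n w i) (u w) a0 => x y z; lra.
Qed.

(** A convergence bound for AMSGrad driven by any adapted stochastic gradient with
conditional bias at most c_n and second moment at most b_n. *)
Lemma amsgrad_expected_gradient N : (forall k, 0 <= c k) ->
  (1 - rho1) * \sum_(n < N) gam n.+1 * ueps delta rho2 eps n *
     E (fun w => enorm (grad V (th n w)) ^+ 2) <=
    ((V theta0 - Vmin) + d%:R * (G ^+ 2 + G * a0 ^+ 2))
    + (2 * (L ^+ 2 + 1) * a0 ^+ 2 + G) * (\sum_(n < N) gam n.+1 ^+ 2 * b n)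
    + G * a0 * \sum_(n < N) (gam n.-1.+1 - gam n.+1) * (d%:R + b n)
    + d%:R * (a0 * G) * \sum_(n < N) gam n.+1 * c n.
Proof.
move=> c0; have /andP[r0 r1] := rho1_01; have r1' : 0 <= 1 - rho1 by lra.
pose D n w := \sum_i h n w i * a w n i * g n w i 0.
pose dg n := gam n.-1.+1 - gam n.+1.
pose B0 := (V theta0 - Vmin) + d%:R * (G ^+ 2 + G * a0 ^+ 2).
pose B1 := 2 * (L ^+ 2 + 1) * a0 ^+ 2 + G.
pose S w := (1 - rho1) * \sum_(n < N) gam n.+1 * D n w.
pose S1 w := \sum_(n < N) gam n.+1 ^+ 2 * q n.+1 w.
pose S2 w := \sum_(n < N) dg n * (d%:R + q n w).
have dg_ge0 n : 0 <= dg n.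
  by rewrite subr_ge0 gam_noninc//; case: n => //= n; rewrite ltnS leqnSn.
have a00 : 0 <= a0 by rewrite invr_ge0 sqrtr_ge0.
have Lq n : L1 (q n) by have [] := momentum_sqr_le n.
have LD n : L1 (D n) by apply: L1_sum => i; exact: Lhag.
have Ldq n : L1 (fun w => d%:R + q n w) by apply: L1D => //; exact: L1_cst.
have LS1 : L1 S1 by apply: L1_sum => n; exact: L1Z.
have LS2 : L1 S2 by apply: L1_sum => n; exact: L1Z.
have LSD : L1 (fun w => \sum_(n < N) gam n.+1 * D n w).
  by apply: L1_sum => n; exact: L1Z.
have LB01 : L1 (fun w => B0 + B1 * S1 w) by apply: L1D; [exact: L1_cst|exact: L1Z].
have pathwise w : S w <= (B0 + B1 * S1 w) + G * a0 * S2 w.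
  have := @amsgrad_run_pathwise R d rho1 rho2 delta gam eps theta0 (est w)
    delta_gt0 V L G Vmin N rho1_01 gam_gt0 gam_noninc V_min V_diff V_lip G_ge0 grad_le.
  congr (_ <= _ + _ * _); apply: eq_bigr => n _.
  by congr (_ * _); rewrite big_split /= sumr_const card_ord.
have expected : (1 - rho1) * \sum_(n < N) E (fun w => gam n.+1 * D n w) <=
    B0 + B1 * \sum_(n < N) E (fun w => gam n.+1 ^+ 2 * q n.+1 w)
    + G * a0 * \sum_(n < N) E (fun w => dg n * (d%:R + q n w)).
  have := E_le (L1Z (1 - rho1) LSD) (L1D LB01 (L1Z (G * a0) LS2)) pathwise.
  rewrite RintegralZl// RintegralD//; last exact: L1Z.
  rewrite RintegralD//; [|exact: L1_cst|exact: L1Z].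
  by rewrite E_cst !RintegralZl// !E_sum// => n; exact: L1Z.
have eD : \sum_(n < N) gam n.+1 * ueps delta rho2 eps n *
      E (fun w => enorm (grad V (th n w)) ^+ 2)
    - d%:R * (a0 * G) * \sum_(n < N) gam n.+1 * c n <=
    \sum_(n < N) E (fun w => gam n.+1 * D n w).
  rewrite mulr_sumr -sumrB; apply: ler_sum => n _; rewrite RintegralZl//.
  have := ler_wpM2l (ltW (gam_gt0 (ltn0Sn n))) (drift_le n c0).
  apply: le_trans; rewrite le_eqVlt; apply/orP; left; apply/eqP.
  by move: (E _) a0 => x y; ring.
have e1 : \sum_(n < N) E (fun w => gam n.+1 ^+ 2 * q n.+1 w) <=
    \sum_(n < N) gam n.+1 ^+ 2 * b n.
  apply: ler_sum => n _; rewrite RintegralZl// ler_wpM2l ?sqr_ge0//.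
  by have [] := momentum_sqr_le n.+1.
have e2 : \sum_(n < N) E (fun w => dg n * (d%:R + q n w)) <=
    \sum_(n < N) dg n * (d%:R + b n).
  apply: ler_sum => n _; rewrite RintegralZl// ler_wpM2l//.
  rewrite RintegralD//; last exact: L1_cst.
  rewrite E_cst lerD2l; have [_ /le_trans->//] := momentum_sqr_le n.
  by case: (nat_of_ord n) => //= k; exact: b_nondec.
have B1_ge0 : 0 <= B1.
  by rewrite addr_ge0// !mulr_ge0 ?addr_ge0 ?sqr_ge0.
have Ga0 : 0 <= G * a0 by rewrite mulr_ge0.
have c_ge0 : 0 <= d%:R * (a0 * G) * \sum_(n < N) gam n.+1 * c n.
  rewrite !mulr_ge0// sumr_ge0// => n _.
  by rewrite mulr_ge0// ltW// gam_gt0.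
have := ler_wpM2l r1' eD; have := ler_wpM2l B1_ge0 e1.
have := ler_wpM2l Ga0 e2.
have : (1 - rho1) * (d%:R * (a0 * G) * \sum_(n < N) gam n.+1 * c n) <=
  d%:R * (a0 * G) * \sum_(n < N) gam n.+1 * c n by rewrite ler_piMl//; lra.
rewrite -/B0 -/B1.
have -> : \sum_(n < N) (gam n.-1.+1 - gam n.+1) * (d%:R + b n) =
  \sum_(n < N) dg n * (d%:R + b n) by [].
move: expected; move: (\sum_(n < N) gam n.+1 * ueps delta rho2 eps n * _).
by move: (_ * \sum_(n < N) gam n.+1 * c n) (G * a0) => t4 t5 t6; lra.
Qed.

End stochastic_amsgrad.

(** * Random stopping index *)

Section random_index.
Context {R : realType} {dO : measure_display} {Omega : measurableType dO}.
Variable P : probability Omega R.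
Local Notation E f := (Rintegral P setT f).

(** Independence says that the indicator of A minus p integrates to 0 on every
event of F. *)
Lemma indep_event_expectation (F : set (set Omega)) (A : set Omega)
    (f : Omega -> R) (p M : R) :
  (forall B, F B -> measurable B) -> measurable A -> P A = p%:E ->
  (forall B, F B -> P (A `&` B) = (P A * P B)%E) ->
  measurable_wrt F f -> (forall w, `|f w| <= M) ->
  E (fun w => f w * \1_A w) = p * E f.
Proof.
move=> Fm mA PA indep Ff fM.
have mf : measurable_fun setT f by move=> _ B mB; rewrite setTI; exact/Fm/Ff.
have Lf := L1_bounded P mf fM.
have LA := L1_indic P mA.
have A1 w : `|\1_A w| <= 1 :> R.
  by rewrite indicE; case: (_ \in _); rewrite ?normr1 ?normr0.
have LfA := L1_mul_bounded Lf (L1_measurable LA) A1.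
have := E_mul_eq0 Fm (L1B LA (L1_cst P p)) _ Ff fM.
under eq_Rintegral do rewrite mulrBl mulrC.
rewrite RintegralB//; last exact: L1Z.
rewrite RintegralZl// => e; apply/eqP; rewrite -subr_eq0; apply/eqP/e => B FB.
have mB := Fm _ FB.
rewrite RintegralB//; [|exact: integrableS LA|exact: (integrableS _ _ _ (L1_cst P p))].
have -> : \int[P]_(w in B) \1_A w = p * fine (P B).
  rewrite /Rintegral integral_indic//.
  transitivity (fine (P A * P B)); first by congr fine; exact: indep.
  by rewrite PA fineM//; exact: fin_num_measure.
by rewrite Rintegral_cst// subrr.
Qed.

(** On the event that I is at least N, the function is bounded by M times
1 - \sum_(n < N) \1_(I = n), whose expectation is 0. This avoids discussing
that null event. *)
Lemma expectation_random_index (F : set (set Omega)) (I : {RV P >-> nat})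
    (f : nat -> Omega -> R) (M : R) (p : nat -> R) (N : nat) :
  (forall B, F B -> measurable B) -> independent P (sigma_of I) F ->
  (forall n, measurable_wrt F (f n)) -> (forall n w, 0 <= f n w <= M) ->
  (forall n, (n < N)%N -> P (I @^-1` [set n]) = (p n)%:E) ->
  \sum_(n < N) p n = 1 ->
  ('E_P[fun w => f (I w) w] <= (\sum_(n < N) p n * E (f n))%:E)%E.
Proof.
move=> Fm indep Ff f0M Pp p1.
pose A n := I @^-1` [set n].
have mI : measurable_fun setT I by exact: measurable_funP.
have mA n : measurable (A n) by rewrite -[A n]setTI; exact: mI.
have sA n : sigma_of I (A n) by exists [set n] => //; rewrite setTI.
have fM n w : `|f n w| <= M by have /andP[f0 fM] := f0M n w; rewrite ger0_norm.
have mf n : measurable_fun setT (f n).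
  by move=> _ B mB; rewrite setTI; exact/Fm/Ff.
pose g w := f (I w) w.
have mg : measurable_fun setT g.
  move=> _ B mB; rewrite setTI.
  have -> : g @^-1` B = \bigcup_n (A n `&` f n @^-1` B).
    by apply/seteqP; split => [w Bw|w [n _ [/= <-]]] //; exists (I w).
  apply: bigcupT_measurable => n; apply: measurableI => //.
  by rewrite -[X in measurable X]setTI; exact: mf.
have Lg : P.-integrable setT (EFin \o g).
  by apply: (@L1_bounded _ _ _ _ _ M) => // w; exact: fM.
have -> : ('E_P[g] = (E g)%:E)%E.
  by rewrite unlock /Rintegral fineK//; exact: integrable_fin_num.
have A1 n w : `|\1_(A n) w| <= 1 :> R.
  by rewrite indicE; case: (_ \in _); rewrite ?normr1 ?normr0.
have Lf n : P.-integrable setT (EFin \o (fun w => f n w * \1_(A n) w)).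
  apply: (@L1_mul_bounded _ _ _ _ _ _ 1) => //.
  exact: (L1_bounded P (mf n) (fM n)).
have LA n : P.-integrable setT (EFin \o (\1_(A n) : Omega -> R)) by exact: L1_indic.
pose s w := \sum_(n < N) f n w * \1_(A n) w.
pose t w : R := 1 - \sum_(n < N) \1_(A n) w.
have Ls : P.-integrable setT (EFin \o s) by apply: L1_sum => n; exact: Lf.
have Lt : P.-integrable setT (EFin \o t).
  by apply: L1B; [exact: L1_cst|apply: L1_sum => n; exact: LA].
(* t is the indicator that I is at least N. *)
have gst w : g w <= s w + M * t w.
  have AE n : \1_(A n) w = (I w == n)%:R :> R.
    by rewrite indicE; congr (nat_of_bool _)%:R; apply/idP/eqP; rewrite inE.
  have [IN|NI] := ltnP (I w) N.
    have sE (u : nat -> R) : \sum_(n < N) u n * \1_(A n) w = u (I w).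
      rewrite (bigD1 (Ordinal IN))//= AE eqxx mulr1 big1 ?addr0// => n nI.
      rewrite AE; case: eqP => [In|_]; last by rewrite mulr0.
      by case/eqP: nI; exact: val_inj.
    have t0 : t w = 0.
      have := sE (fun=> 1); under eq_bigr do rewrite mul1r.
      by rewrite /t => ->; rewrite subrr.
    by rewrite t0 mulr0 addr0 /s (sE (f ^~ w)).
  have A0 (n : 'I_N) : \1_(A n) w = 0 :> R.
    by rewrite AE gtn_eqF// (leq_trans (ltn_ord n)).
  rewrite /s /t; under eq_bigr do rewrite A0 mulr0.
  under [in X in 1 - X]eq_bigr do rewrite A0.
  by rewrite !big1// subr0 mulr1 add0r; have /andP[_] := f0M (I w) w.
rewrite lee_fin; apply: le_trans (E_le Lg (L1D Ls (L1Z M Lt)) gst) _.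
rewrite RintegralD//; last exact: L1Z.
rewrite RintegralZl// /t RintegralB//; [|exact: L1_cst|by apply: L1_sum => n].
rewrite E_cst !E_sum//.
have -> : \sum_(n < N) E (\1_(A n)) = \sum_(n < N) p n.
  apply: eq_bigr => n _; rewrite /Rintegral integral_indic// setIT.
  by transitivity (fine (p n)%:E); first by congr fine; exact: Pp.
rewrite p1 subrr mulr0 addr0 le_eqVlt; apply/orP; left; apply/eqP.
apply: eq_bigr => n _.
apply: (indep_event_expectation Fm (mA n) (Pp n (ltn_ord n)) _ (Ff n) (fM n)).
by move=> B FB; exact: indep.
Qed.

End random_index.

Section history.
Context {dO : measure_display} {Omega : measurableType dO} {R : realType}
  {P : probability Omega R} {dX : measure_display} {X : measurableType dX}.
Variables (Xs : nat -> nat -> {RV P >-> X}) (K : nat -> {RV P >-> nat}).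

Lemma sigma_of_measurable dY (Y : measurableType dY) (f : {RV P >-> Y}) A :
  sigma_of f A -> measurable A.
Proof.
have mf : measurable_fun setT f by exact: measurable_funP.
by move=> [B mB <-]; exact: mf.
Qed.

Lemma history_measurable J A : history Xs K J A -> measurable A.
Proof.
apply: smallest_sub; first exact: sigma_algebra_measurable.
move=> B [n _ [|[i _]]]; exact: sigma_of_measurable.
Qed.

Lemma historyS J J' : J `<=` J' -> history Xs K J `<=` history Xs K J'.
Proof. by move=> JJ'; apply: sub_sigma_algebra2; apply: bigcup_subset. Qed.

End history.

(** * Rates for power sequences *)

Section rates_of_corollary.
Context {R : realType}.
Implicit Types (gam eps T : nat -> R).

Lemma sum_step_over_truncation gam T gamma alpha :
  propto_pow gam (- gamma) -> propto_pow T alpha ->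
  exists2 C, 0 <= C & forall N, (2 <= N)%N ->
  \sum_(n < N.+1) gam n.+1 / T n.+1 <= C * (1 + Psi N (alpha + gamma)).
Proof.
move=> [cg cg0 gE] [ct ct0 TE]; have [C C0 HC] := sum_powR_Psi (alpha + gamma).
exists (cg / ct * C); first by rewrite mulr_ge0// divr_ge0 ?ltW.
move=> N N2; rewrite -[leRHS]mulrA.
apply: le_trans (ler_wpM2l _ (HC N N2)); last by rewrite divr_ge0 ?ltW.
rewrite mulr_sumr; apply: ler_sum => n _; rewrite gE// TE//.
rewrite opprD addrC powRD ?pnatr_eq0 ?implybT// [_ `^ (- alpha)]powRN.
by rewrite invfM le_eqVlt; apply/orP; left; apply/eqP;
  move: (_ `^ _) (_ `^ _)^-1 => x y; ring.
Qed.

Lemma sum_sqr_step_log gam gamma kb :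
  0 <= kb -> propto_pow gam (- gamma) ->
  exists2 C, 0 <= C & forall N, (2 <= N)%N ->
  \sum_(n < N.+1) gam n.+1 ^+ 2 * (kb * (1 + ln n.+1%:R))
    <= C * (1 + Phi N (2 * gamma)).
Proof.
move=> kb0 [cg cg0 gE]; have [C C0 HC] := sum_powR_ln_Phi (2 * gamma).
exists (cg ^+ 2 * kb * C); first by rewrite !mulr_ge0// ltW.
move=> N N2; rewrite -[leRHS]mulrA.
apply: le_trans (ler_wpM2l _ (HC N N2)); last by rewrite mulr_ge0// sqr_ge0.
rewrite mulr_sumr; apply: ler_sum => n _; rewrite gE// exprMn.
have -> : n.+1%:R `^ (- (2 * gamma)) = (n.+1%:R `^ (- gamma)) ^+ 2 :> R.
  rewrite expr2 -powRD ?pnatr_eq0 ?implybT//; congr (_ `^ _); ring.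
by rewrite le_eqVlt; apply/orP; left; apply/eqP; ring.
Qed.

(** For gamma = 0 the step size is constant and the sum vanishes; otherwise the
increments telescope and the other factor is at most its last value, of order
log N. This is the origin of the term gamma log N. *)
Lemma sum_step_increments gam gamma kb D :
  0 <= kb -> 0 <= D -> 0 <= gamma -> propto_pow gam (- gamma) ->
  (forall m n, (1 <= m <= n)%N -> gam n <= gam m) ->
  (forall n, (1 <= n)%N -> 0 < gam n) ->
  exists2 C, 0 <= C & forall N, (2 <= N)%N ->
  \sum_(n < N.+1) (gam n.-1.+1 - gam n.+1) * (D + kb * (1 + ln n.+1%:R))
    <= C * (gamma * ln N%:R).
Proof.
move=> kb0 D0 gamma0 [cg cg0 gE] gam_noninc gam_gt0.
have lnN N : (2 <= N)%N -> 0 <= ln N%:R :> R.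
  by move=> N2; rewrite ln_ge0// ler1n (leq_trans _ N2).
have [g0|gN0] := eqVneq gamma 0.
  exists 0 => // N N2; rewrite mul0r big1// => n _.
  by rewrite !gE// g0 oppr0 !powRr0 subrr mul0r.
have g_gt0 : 0 < gamma by rewrite lt_neqAle eq_sym gN0.
pose c : R := (ln 2)^-1 + 2.
have c0 : 0 <= c by rewrite addr_ge0// invr_ge0 ltW// ln2_gt0.
exists (gam 1 * ((D + kb) * c) / gamma).
  by rewrite divr_ge0// mulr_ge0 ?(ltW (gam_gt0 _ _))// mulr_ge0// addr_ge0.
move=> N N2.
have -> : gam 1 * ((D + kb) * c) / gamma * (gamma * ln N%:R) =
    gam 1 * ((D + kb) * (c * ln N%:R)) by field; rewrite gt_eqF.
have l0 : 0 <= ln N.+1%:R :> R by rewrite ln_ge0// ler1n.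
have telescope M : \sum_(n < M.+1) (gam n.-1.+1 - gam n.+1) = gam 1 - gam M.+1.
  elim: M => [|M IH]; first by rewrite big_ord1 subrr.
  by rewrite big_ord_recr /= IH addrA subrK.
apply: (@le_trans _ _ (\sum_(n < N.+1) (gam n.-1.+1 - gam n.+1) *
    ((D + kb) * (1 + ln N.+1%:R)))).
  apply: ler_sum => n _; rewrite ler_wpM2l//.
    by rewrite subr_ge0 gam_noninc//; case: (nat_of_ord n) => //= k; lia.
  rewrite mulrDl lerD//; first by rewrite ler_peMr// lerDl.
  by rewrite ler_wpM2l// lerD2l ler_ln ?posrE// ler_nat ltn_ord.
rewrite -mulr_suml telescope; apply: ler_pM.
- by rewrite subr_ge0 gam_noninc.
- by rewrite mulr_ge0 ?addr_ge0.
- by rewrite gerBl ltW// gam_gt0.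
- by rewrite ler_wpM2l ?addr_ge0// log_factor_le.
Qed.

(** Every term of varpi_N of positive index is at least a constant times
N^(- gamma - ebar / 2), because the step sizes decrease and eps_n grows at most
like n^ebar. *)
Lemma varpi_lower gam eps delta rho2 gamma ebar :
  propto_pow gam (- gamma) -> propto_pow eps ebar ->
  0 <= gamma -> 0 <= ebar -> 0 <= rho2 < 1 -> 0 < delta ->
  exists2 k, 0 < k & forall N, (2 <= N)%N ->
    k * N%:R `^ (1 - gamma - ebar / 2) <= varpi gam (ueps delta rho2 eps) N.
Proof.
move=> [cg cg0 gE] [ce ce0 eE] g0 e0 /andP[r0 r1] delta0.
have dc : 0 < delta + ce by rewrite addr_gt0.
exists (cg * 2 `^ (- gamma) * (Num.sqrt (delta + ce))^-1).
  by rewrite !mulr_gt0 ?powR_gt0 ?invr_gt0 ?sqrtr_gt0.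
move=> N N2; have N0 : 0 < N%:R :> R by rewrite ltr0n (leq_trans _ N2).
have N1 : 1 <= N%:R :> R by rewrite ler1n (leq_trans _ N2).
have ueB k : (k < N)%N ->
    (Num.sqrt (delta + ce))^-1 * N%:R `^ (- (ebar / 2)) <=
    ueps delta rho2 eps k.+1.
  move=> kN; have k1 : 1 <= k.+1%:R `^ ebar :> R.
    by rewrite -[leLHS](powRr0 k.+1%:R) ler_powR// ler1n.
  have kNe : k.+1%:R `^ ebar <= N%:R `^ ebar :> R.
    by rewrite ge0_ler_powR ?nnegrE// ler_nat.
  have -> : N%:R `^ (- (ebar / 2)) = (Num.sqrt (N%:R `^ ebar))^-1 :> R.
    by rewrite powRN powRrM powR12_sqrt// powR_ge0.
  have rk : 0 <= 1 - rho2 ^+ k.+1 <= 1.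
    by rewrite subr_ge0 exprn_ile1 ?(ltW r1)//= gerBl exprn_ge0.
  have /andP[rk0 rk1] := rk.
  rewrite /ueps eE// -invfM -sqrtrM ?(ltW dc)//.
  have x0 : 0 <= ce * k.+1%:R `^ ebar * (1 - rho2 ^+ k.+1).
    by rewrite !mulr_ge0 ?powR_ge0// ltW.
  have X0 : 0 < (delta + ce) * N%:R `^ ebar by rewrite mulr_gt0// powR_gt0.
  rewrite lef_pV2 ?posrE ?sqrtr_gt0//; last by rewrite ltr_wpDr.
  rewrite ler_wsqrtr// mulrDl lerD//.
    by rewrite ler_peMr ?(ltW delta0)// (le_trans k1).
  rewrite -mulrA ler_wpM2l ?(ltW ce0)// (le_trans _ kNe)//.
  by rewrite ler_piMr ?powR_ge0.
have gB k : (k < N)%N -> cg * (2 `^ (- gamma) * N%:R `^ (- gamma)) <= gam k.+2.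
  move=> kN; rewrite gE// ler_wpM2l ?(ltW cg0)// !powRN -invfM.
  rewrite lef_pV2 ?posrE ?mulr_gt0 ?powR_gt0// -powRM//.
  by rewrite ge0_ler_powR ?nnegrE ?mulr_ge0// -natrM ler_nat; lia.
rewrite /varpi big_mkord big_ord_recl /= mulr0 add0r.
have -> : N%:R `^ (1 - gamma - ebar / 2) =
    N%:R * (N%:R `^ (- gamma) * N%:R `^ (- (ebar / 2))) :> R.
  rewrite -{2}(@powRr1 R N%:R)// -!powRD ?(gt_eqF N0) ?implybT//.
  by congr (_ `^ _); ring.
have -> : cg * 2 `^ (- gamma) / Num.sqrt (delta + ce) *
    (N%:R * (N%:R `^ (- gamma) * N%:R `^ (- (ebar / 2)))) =
  \sum_(k < N) (cg * (2 `^ (- gamma) * N%:R `^ (- gamma))) *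
    ((Num.sqrt (delta + ce))^-1 * N%:R `^ (- (ebar / 2))).
  rewrite sumr_const card_ord -[RHS]mulr_natl.
  by move: (Num.sqrt _)^-1 (2 `^ _) (N%:R `^ (- gamma)) (N%:R `^ _) => w x y z; ring.
apply: ler_sum => k _; apply: ler_pM; rewrite ?gB ?ueB//.
by rewrite !mulr_ge0 ?powR_ge0// ltW.
Qed.

(** A bound that is non-negative and non-decreasing in n even where ln (T n) is
negative, so that it can serve as second moment bound. *)
Lemma log_truncation_le T alpha c2 G :
  propto_pow T alpha -> 0 <= alpha ->
  exists2 kb, 0 <= kb & forall n,
    c2 * G ^+ 2 * ln (T n.+1) <= kb * (1 + ln n.+1%:R).
Proof.
move=> [ct ct0 TE] alpha0; exists (`|c2| * G ^+ 2 * (`|ln ct| + alpha)).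
  by apply: mulr_ge0; [rewrite mulr_ge0 ?sqr_ge0|rewrite addr_ge0].
move=> n; have l0 : 0 <= ln n.+1%:R :> R by rewrite ln_ge0// ler1n.
apply: le_trans (ler_norm _) _; rewrite 2!normrM (ger0_norm (sqr_ge0 G)).
rewrite -[leRHS]mulrA ler_wpM2l//; first by rewrite mulr_ge0// sqr_ge0.
rewrite TE// lnM ?posrE ?powR_gt0// ln_powR.
apply: le_trans (ler_normD _ _) _.
rewrite normrM (ger0_norm alpha0) (ger0_norm l0) mulrDl.
rewrite lerD// ?ler_peMr ?lerDl//.
by rewrite ler_wpM2l// lerDr.
Qed.

End rates_of_corollary.

(** * MLMC-AMSGrad *)

Theorem corollary3p6 (R : realType) (d : nat)
    (* objective *)
    (V : 'cV[R]_d -> R) (thetastar : 'cV[R]_d)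
    (V_min : forall theta, V thetastar <= V theta)
    (* random field, kernels and invariant probabilities *)
    (dX : measure_display) (X : measurableType dX)
    (H : 'cV[R]_d -> X -> 'cV[R]_d)
    (H_meas : forall theta, measurable_vec (H theta))
    (kern : 'cV[R]_d -> R.-pker X ~> X)
    (pi : 'cV[R]_d -> probability X R)
    (pi_inv : forall theta (B : set X), measurable B ->
      (\int[pi theta]_x kern theta x B = pi theta B)%E)
    (h_grad : forall theta, mean_field (pi theta) (H theta) = grad V theta)
    (* algorithm *)
    (dO : measure_display) (Omega : measurableType dO)
    (P : probability Omega R)
    (Xs : nat -> nat -> {RV P >-> X}) (K : nat -> {RV P >-> nat})
    (rho1 rho2 delta : R) (gam T eps : nat -> R) (theta0 : 'cV[R]_d)
    (rho1_01 : 0 <= rho1 < 1) (rho2_01 : 0 <= rho2 < 1) (delta_gt0 : 0 < delta)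
    (gam_gt0 : forall n, (1 <= n)%N -> 0 < gam n)
    (gam_noninc : forall m n, (1 <= m <= n)%N -> gam n <= gam m)
    (T_gt0 : forall n, (1 <= n)%N -> 0 < T n)
    (T_nondec : forall m n, (1 <= m <= n)%N -> T m <= T n)
    (eps_gt0 : forall n, (1 <= n)%N -> 0 < eps n)
    (eps_nondec : forall m n, (1 <= m <= n)%N -> eps m <= eps n) :
  let theta := mlmc_theta rho1 rho2 delta gam eps theta0 H T Xs K in
  let Hhat := mlmc_Hhat rho1 rho2 delta gam eps theta0 H T Xs K in
  mlmc_sampling Xs K theta kern ->
  (forall n i, measurable_wrt (past Xs K n.+1) (fun w => Hhat n.+1 w i 0)) ->
  forall (L G c1 c2 alpha gamma ebar : R),
  (* (i) *)
  (forall x, differentiable V x) ->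
  (forall x y, enorm (grad V x - grad V y) <= L * enorm (x - y)) ->
  (* (ii) *)
  0 < G ->
  (forall x, (supnorm (H x) <= G%:E)%E) ->
  (* (iii) *)
  (forall n, exists2 Z : Omega -> 'cV[R]_d,
    is_condexp_vec P (past Xs K n) (Hhat n.+1) Z &
    {ae P, forall w,
      enorm (Z w - mean_field (pi (theta n w)) (H (theta n w)))
        <= c1 * G / T n.+1}) ->
  (forall n, ('E_P[fun w => (enorm (Hhat n.+1 w) ^+ 2)%R]
                <= (c2 * G ^+ 2 * ln (T n.+1))%:E)%E) ->
  (* (iv) *)
  propto_pow gam (- gamma) -> propto_pow eps ebar -> propto_pow T alpha ->
  0 < alpha -> 0 <= gamma -> 0 <= ebar -> 2 * gamma + ebar < 2 ->
  (* random stopping index, one for each horizon N *)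
  let ue := ueps delta rho2 eps in
  forall Rstop : nat -> {RV P >-> nat},
  (forall N, (1 <= N)%N ->
    independent P (sigma_of (Rstop N)) (history Xs K [set n | (1 <= n)%N])) ->
  (forall N n, (1 <= N)%N -> (n <= N)%N ->
    P (Rstop N @^-1` [set n]) = (gam n.+1 * ue n / varpi gam ue N)%:E) ->
  exists C : R, \forall N \near \oo,
    ('E_P[fun w => (enorm (grad V (theta (Rstop N w) w)) ^+ 2)%R]
      <= (C * ((N%:R `^ (1 - gamma - ebar / 2))^-1
               * (1 + Psi N (alpha + gamma) + Phi N (2 * gamma)
                  + gamma * ln N%:R)))%:E)%E.
Proof.
move=> theta Hhat _ Hhat_adapted L G c1 c2 alpha gamma ebar V_diff V_lip G_gt0
  H_le Hhat_bias Hhat_sqr gamE epsE TE alpha_gt0 gamma_ge0 ebar_ge0 _ ue Rstop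
  Rstop_indep Rstop_law.
have G_ge0 := ltW G_gt0.
have /andP[rho1_ge0 rho1_lt1] := rho1_01.
pose gen n := \bigcup_(k in [set k | (1 <= k <= n)%N])
  (sigma_of (K k) `|` chain_events Xs k [set i | (1 <= i)%N]).
pose est w k x := mlmc (H x) (T k) (fun i => Xs k i w) (K k w).
have grad_le x i : `|grad V x i 0| <= G.
  by rewrite -h_grad; exact: mean_field_coord_le.
have [kb kb_ge0 ln_le] := log_truncation_le c2 G TE (ltW alpha_gt0).
pose b n : R := kb * (1 + ln n.+1%:R).
pose c n : R := `|c1| * G / T n.+1.
have lnS_ge0 n : 0 <= ln n.+1%:R :> R by rewrite ln_ge0// ler1n.
have b_ge0 n : 0 <= b n by rewrite mulr_ge0// addr_ge0.
have b_nondec n : b n <= b n.+1.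
  by rewrite ler_wpM2l// lerD2l ler_ln ?posrE// ler_nat.
have c_ge0 n : 0 <= c n by rewrite divr_ge0 ?mulr_ge0// ltW// T_gt0.
have gen_measurable n A : <<s gen n >> A -> measurable A.
  exact: history_measurable.
have gen_mono m n : (m <= n)%N -> <<s gen m >> `<=` <<s gen n >>.
  by move=> mn; apply: historyS => k /= /andP[-> /leq_trans->].
have mHhat n i : measurable_fun setT (fun w => Hhat n.+1 w i 0).
  move=> _ B mB; rewrite setTI.
  exact: (gen_measurable n.+1 _ (Hhat_adapted n i B mB)).
have int_sqr_le n : (\int[P]_w (enorm (Hhat n.+1 w) ^+ 2)%:E <= (b n)%:E)%E.
  by have := Hhat_sqr n; rewrite unlock => /le_trans; apply; rewrite lee_fin.
have sqr_int n : P.-integrable setT (EFin \o (fun w => enorm (Hhat n.+1 w) ^+ 2)).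
  apply/integrableP; split.
    apply/measurable_EFinP; under eq_fun do rewrite enorm_sqr.
    by apply: measurable_sum => i; exact: measurable_funX.
  apply: le_lt_trans (ltry (b n)); apply: le_trans (int_sqr_le n).
  under eq_integral do rewrite /= ger0_norm ?sqr_ge0//.
  exact: lexx.
have sqr_le n : \int[P]_w (enorm (Hhat n.+1 w) ^+ 2) <= b n.
  rewrite -lee_fin /Rintegral fineK; first exact: int_sqr_le.
  exact: (integrable_fin_num _ (sqr_int n)).
have bias n : exists2 Z : Omega -> 'cV[R]_d,
    is_condexp_vec P <<s gen n >> (Hhat n.+1) Z &
    {ae P, forall w, enorm (Z w - grad V (theta n w)) <= c n}.
  have [Z Z_ce Zb] := Hhat_bias n; exists Z => //.
  apply: filterS Zb => w; rewrite h_grad => /le_trans; apply.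
  by rewrite /c ler_pM2r ?invr_gt0 ?T_gt0// ler_wpM2r// ler_norm.
have core N := @amsgrad_expected_gradient R d dO Omega P rho1 rho2 delta gam eps
  theta0 est gen V L G (V thetastar) b c rho1_01 rho2_01 delta_gt0 gam_gt0
  gam_noninc eps_gt0 eps_nondec V_min V_diff V_lip G_ge0 grad_le gen_measurable
  gen_mono Hhat_adapted sqr_int sqr_le b_ge0 b_nondec bias N c_ge0.
pose f n w := enorm (grad V (theta n w)) ^+ 2.
have f_adapted n : measurable_wrt (history Xs K [set n | (1 <= n)%N]) (f n).
  apply: (measurable_wrtS (F := <<s gen n >>)).
    by apply: historyS => k /= /andP[].
  have -> : f n = fun w => \sum_i grad V (theta n w) i 0 ^+ 2.
    by apply/funext => w; rewrite /f enorm_sqr.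
  apply/measurable_wrtP; apply: measurable_sum => i.
  apply: measurable_funX; apply/measurable_wrtP.
  exact: (@grad_adapted R d dO Omega rho1 rho2 delta gam eps theta0 est gen V L
    delta_gt0 V_lip gen_mono Hhat_adapted n i).
have f_bound n w : 0 <= f n w <= d%:R * G ^+ 2.
  rewrite sqr_ge0 /f enorm_sqr -[d in d%:R]card_ord mulr_natl -sumr_const /=.
  apply: ler_sum => i _.
  by rewrite -real_normK ?num_real// ler_sqr ?nnegrE.
have [k k_gt0 varpi_ge] := varpi_lower gamE epsE gamma_ge0 ebar_ge0 rho2_01 delta_gt0.
have [C1 C1_ge0 S1] := sum_sqr_step_log kb_ge0 gamE.
have [C2 C2_ge0 S2] :=
  sum_step_increments kb_ge0 (ler0n R d) gamma_ge0 gamE gam_noninc gam_gt0.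
have [C3 C3_ge0 S3] := sum_step_over_truncation gamE TE.
pose a0 := (Num.sqrt delta)^-1.
have a0_ge0 : 0 <= a0 by rewrite invr_ge0 sqrtr_ge0.
pose B0 := (V theta0 - V thetastar) + d%:R * (G ^+ 2 + G * a0 ^+ 2).
have B0_ge0 : 0 <= B0.
  apply: addr_ge0; first by rewrite subr_ge0.
  by apply: mulr_ge0 => //; rewrite addr_ge0 ?sqr_ge0// mulr_ge0// sqr_ge0.
pose B1 := 2 * (L ^+ 2 + 1) * a0 ^+ 2 + G.
have B1_ge0 : 0 <= B1.
  apply: addr_ge0 => //; apply: mulr_ge0; last exact: sqr_ge0.
  by apply: mulr_ge0 => //; rewrite addr_ge0 ?sqr_ge0.
pose B3 := d%:R * (a0 * G) * (`|c1| * G).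
have B3_ge0 : 0 <= B3 by rewrite /B3 !mulr_ge0.
pose C4 := B0 + B1 * C1 + G * a0 * C2 + B3 * C3.
have Ga0_ge0 : 0 <= G * a0 by rewrite mulr_ge0.
have [p1 p2 p3] : [/\ 0 <= B1 * C1, 0 <= G * a0 * C2 & 0 <= B3 * C3].
  by split; rewrite mulr_ge0.
have C4_ge0 : 0 <= C4 by rewrite /C4; lra.
exists (C4 / (1 - rho1) / k); near=> N.
have N2 : (2 <= N)%N by near: N; exact: nbhs_infty_ge.
have N1 : (1 <= N)%N := ltnW N2.
pose Q := 1 + Psi N (alpha + gamma) + Phi N (2 * gamma) + gamma * ln N%:R.
have Psi0 := Psi_ge0 (alpha + gamma) N2.
have Phi0 := Phi_ge0 (2 * gamma) N2.
have gln0 : 0 <= gamma * ln N%:R.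
  by rewrite mulr_ge0// -(prednK N1) lnS_ge0.
pose Ef n := \int[P]_w f n w.
have sum_bound : (1 - rho1) * \sum_(n < N.+1) gam n.+1 * ue n * Ef n <= C4 * Q.
  apply: le_trans (core N.+1) _; rewrite -/a0 -/B0 -/B1.
  have -> : d%:R * (a0 * G) * \sum_(n < N.+1) gam n.+1 * c n =
      B3 * \sum_(n < N.+1) gam n.+1 / T n.+1.
    rewrite /B3 -[RHS]mulrA [in RHS]mulr_sumr; congr (_ * _).
    by apply: eq_bigr => n _; rewrite /c mulrCA.
  have e1 := ler_wpM2l B1_ge0 (S1 N N2).
  have e2 := ler_wpM2l Ga0_ge0 (S2 N N2).
  have e3 := ler_wpM2l B3_ge0 (S3 N N2).
  have q1 : B0 <= B0 * Q by rewrite ler_peMr// /Q; lra.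
  have q2 : B1 * (C1 * (1 + Phi N (2 * gamma))) <= B1 * C1 * Q.
    by rewrite [leLHS]mulrA ler_wpM2l// /Q; lra.
  have q3 : G * a0 * (C2 * (gamma * ln N%:R)) <= G * a0 * C2 * Q.
    by rewrite [leLHS]mulrA ler_wpM2l// /Q; lra.
  have q4 : B3 * (C3 * (1 + Psi N (alpha + gamma))) <= B3 * C3 * Q.
    by rewrite [leLHS]mulrA ler_wpM2l// /Q; lra.
  have -> : C4 * Q = B0 * Q + B1 * C1 * Q + G * a0 * C2 * Q + B3 * C3 * Q.
    by rewrite /C4; move: (B0) (B1) (B3) (Q) => x y z t; ring.
  apply: lerD; last exact: le_trans e3 q4.
  apply: lerD; last exact: le_trans e2 q3.
  by apply: lerD => //; exact: le_trans e1 q2.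
have Ne : 0 < N%:R `^ (1 - gamma - ebar / 2) by rewrite powR_gt0// ltr0n.
have varpi_gt0 : 0 < varpi gam ue N.
  by apply: lt_le_trans (varpi_ge N N2); rewrite mulr_gt0.
pose p n := gam n.+1 * ue n / varpi gam ue N.
have p_sum : \sum_(n < N.+1) p n = 1.
  have varpiE : \sum_(n < N.+1) gam n.+1 * ue n = varpi gam ue N.
    by rewrite /varpi big_mkord.
  by rewrite /p -mulr_suml varpiE divff// gt_eqF.
apply: le_trans (expectation_random_index (F := history Xs K [set n | (1 <= n)%N])
  (f := f) (M := d%:R * G ^+ 2) (p := p) (N := N.+1) _ _ _ _ _ _) _ => //.
- exact: history_measurable.
- exact: Rstop_indep.
- by move=> n nN; exact: Rstop_law.
rewrite lee_fin.
have -> : \sum_(n < N.+1) p n * Ef n =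
    (\sum_(n < N.+1) gam n.+1 * ue n * Ef n) / varpi gam ue N.
  by rewrite mulr_suml; apply: eq_bigr => n _; rewrite /p mulrAC.
have rho1' : 0 < 1 - rho1 by rewrite subr_gt0.
have sum_bound' : \sum_(n < N.+1) gam n.+1 * ue n * Ef n <= C4 / (1 - rho1) * Q.
  by rewrite mulrAC ler_pdivlMr// mulrC.
have Q_ge0 : 0 <= C4 / (1 - rho1) * Q.
  apply: mulr_ge0; first by rewrite divr_ge0// ltW.
  by rewrite /Q; lra.
rewrite ler_pdivrMr//; apply: le_trans sum_bound' _.
rewrite -/Q.
have -> : C4 / (1 - rho1) / k * ((N%:R `^ (1 - gamma - ebar / 2))^-1 * Q) =
    C4 / (1 - rho1) * Q / (k * N%:R `^ (1 - gamma - ebar / 2)).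
  by rewrite invfM; ring.
rewrite [leRHS]mulrAC ler_pdivlMr ?mulr_gt0//.
by rewrite ler_wpM2l// varpi_ge.
Unshelve. all: by end_near. Qed.
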